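(* For the background knowledge of causal sufficiency ($\Psi(G)=1$ iff the DMG $G$ contains no bidirected edges), the PC algorithm with Meek's orientation rules, viewed as a mapping $\Phi$ from independence models to DPAGs, is sound, arrowhead complete, tail complete and Markov complete in the $\sigma$-separation setting (for possibly cyclic DMGs, without selection bias). That is: - (sound) for all DMGs $G$ without bidirected edges, $\Phi(\mathrm{IM}_\sigma(G))$ contains $G$; - (arrowhead complete) for all DMGs $G$ without bidirected edges and all distinct $i,j$ adjacent in $\Phi(\mathrm{IM}_\sigma(G))$: if $i\notin\mathrm{an}_{\tilde G}(j)$ for every DMG $\tilde G$ without bidirected edges that is $\sigma$-Markov equivalent to $G$, then the edge between $i$ and $j$ in $\Phi(\mathrm{IM}_\sigma(G))$ has an arrowhead at $i$; - (tail complete) for all DMGs $G$ without bidirected edges and all distinct $i,j$ adjacent in $\Phi(\mathrm{IM}_\sigma(G))$: if $i\in\mathrm{an}_{\tilde G}(j)$ for every DMG $\tilde G$ without bidirected edges that is $\sigma$-Markov equivalent to $G$, then $i\to j$ in $\Phi(\mathrm{IM}_\sigma(G))$; - (Markov complete) for all DMGs $G_1,G_2$ (on the same node set) without bidirected edges, $G_1$ is $\sigma$-Markov equivalent to $G_2$ iff $\Phi(\mathrm{IM}_\sigma(G_1))=\Phi(\mathrm{IM}_\sigma(G_2))$.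
   Context: DMGs. A directed mixed graph (DMG) $G=\langle V,E,F\rangle$ has a finite node set $V$, directed edges $i\to j$ and bidirected edges $i\leftrightarrow j$ between distinct nodes; several edges between two nodes are allowed (at most one of each of $i\to j$, $i\leftarrow j$, $i\leftrightarrow j$). A walk is an alternating sequence of nodes and edges, each edge connecting consecutive nodes; a path is a walk containing each node at most once. $\mathrm{an}_G(j)$ is the set of nodes $i$ with a (possibly trivial) directed path $i\to\dots\to j$; $\mathrm{de}_G(i)=\{j:i\in\mathrm{an}_G(j)\}$; $\mathrm{sc}_G(i)=\mathrm{an}_G(i)\cap\mathrm{de}_G(i)$; $\mathrm{an}_G(I)=\bigcup_{i\in I}\mathrm{an}_G(i)$. A non-endpoint node on a walk is a collider if both adjacent walk edges have an arrowhead at it; other nodes on it are non-colliders. $\sigma$-separation. A walk is $\sigma$-blocked by $C\subseteq V$ if: its first or last node is in $C$; or it contains a collider not in $\mathrm{an}_G(C)$; or it contains a non-endpoint non-collider $k\in C$ with a directed walk edge $k\to l$ to a neighbouring node $l$ on the walk with $l\notin\mathrm{sc}_G(k)$. $A$ is $\sigma$-separated from $B$ by $C$ if all paths between nodes of $A$ and nodes of $B$ are $\sigma$-blocked by $C$. $\mathrm{IM}_\sigma(G)$ is the set of triples $\langle A,B,C\rangle$ of subsets of $V$ such that $A$ is $\sigma$-separated from $B$ by $C$. $G_1,G_2$ are $\sigma$-Markov equivalent if $\mathrm{IM}_\sigma(G_1)=\mathrm{IM}_\sigma(G_2)$. An inducing path between $i$ and $j$ in a DMG $G$ is a path between them on which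 every collider is in $\mathrm{an}_G(\{i,j\})$ and each non-endpoint non-collider only has outgoing directed edges (on the path) to neighbouring nodes on the path in the same strongly connected component of $G$. DPAGs. A directed partial ancestral graph (DPAG) is a mixed graph with edges of types $\to,\leftarrow,\leftrightarrow,\circ\!\!\to,\leftarrow\!\!\circ,\circ\!\!-\!\!\circ$, at most one edge between two distinct nodes, no self-cycles, no directed cycle and no almost directed cycle (directed path from $i$ to $j$ together with $j\leftrightarrow i$), and no inducing path between non-adjacent nodes (a path all of whose non-endpoint nodes are colliders on it and ancestors, via directed paths, of an endpoint). $*$ stands for any edge mark. A DPAG $P$ contains a DMG $G$ with the same node set if: (1) $i,j$ are adjacent in $P$ iff there is an inducing path between them in $G$; (2) $i\,*\!\!\to j$ in $P$ implies $j\notin\mathrm{an}_G(i)$; (3) $i\to j$ in $P$ implies $i\in\mathrm{an}_G(j)$. PC algorithm with Meek's rules. Given an independence model $I$ (set of triples of subsets of $V$): distinct $i,j$ are made adjacent (undirected edge $i-j$) iff there is no $Z\subseteq V\setminus\{i,j\}$ with $\langle\{i\},\{j\},Z\rangle\in I$; for non-adjacent $i,j$ let $\mathrm{SepSet}(i,j)$ be one such $Z$ (chosen by a fixed rule). For each triple $a,c,b$ with $a,c$ adjacent, $c,b$ adjacent, $a,b$ non-adjacent, orient $a\to c\leftarrow b$ iff $c\notin\mathrm{SepSet}(a,b)$. Then apply exhaustively Meek's rules: (1) if $a\to b$, $b-c$, and $a,c$ non-adjacent, orient $b\to c$; (2) if $a\to b\to c$ and $a-c$, orient $a\to c$; (3)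 if $a-b$, $a-c$, $a-d$, $c\to b$, $d\to b$, and $c,d$ non-adjacent, orient $a\to b$. The resulting partially directed graph (CPDAG) is interpreted as a DPAG by replacing every undirected edge $i-j$ by $i\circ\!\!-\!\!\circ j$. *)

(* Defs.v *)
From HB Require Import structures.
From mathcomp Require Import all_boot.
From mathcomp Require Import boolp.

Set Implicit Arguments.
Unset Strict Implicit.
Unset Printing Implicit Defensive.

(* Directed cycles are allowed, in particular [i -> j] together with [j -> i]. *)
Record dmg (V : finType) := Dmg {
  dir : rel V;
  bid : rel V;
  dir_irr : irreflexive dir;
  bid_irr : irreflexive bid;
  bid_sym : symmetric bid }.

Definition an V (G : dmg V) (j : V) : {set V} := [set i | connect (dir G) i j].
Definition de V (G : dmg V) (i : V) : {set V} := [set j | i \in an G j].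
Definition sc V (G : dmg V) (i : V) : {set V} := an G i :&: de G i.
Definition anS V (G : dmg V) (I : {set V}) : {set V} := \bigcup_(i in I) an G i.

(** A walk is given by its first node [i] and the list [s] of its further steps;
    the step [(e, y)] taken at a node [x] traverses [x -> y], [x <- y] or
    [x <-> y], according to [e]. *)

Variant ekind := Fwd | Bwd | Bid.

Definition is_edge V (G : dmg V) (x : V) (e : ekind) (y : V) : bool :=
  match e with Fwd => dir G x y | Bwd => dir G y x | Bid => bid G x y end.

Fixpoint is_walk V (G : dmg V) (x : V) (s : seq (ekind * V)) : bool :=
  if s is (e, y) :: s' then is_edge G x e y && is_walk G y s' else true.

Definition walk_nodes (V : finType) (i : V) (s : seq (ekind * V)) : seq V :=
  i :: unzip2 s.

Definition walk_end (V : finType) (i : V) (s : seq (ekind * V)) : V :=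
  last i (unzip2 s).

Definition is_path V (G : dmg V) (i : V) (s : seq (ekind * V)) : bool :=
  is_walk G i s && uniq (walk_nodes i s).

(* [u e k f l] occurs consecutively on the walk, so that [k] is at a
   non-endpoint position. *)
Definition inner (V : finType) (i : V) (s : seq (ekind * V))
    (u : V) (e : ekind) (k : V) (f : ekind) (l : V) : Prop :=
  exists s1 s2, s = s1 ++ (e, k) :: (f, l) :: s2 /\ u = walk_end i s1.

Definition collider (e f : ekind) : bool :=
  match e, f with Bwd, _ => false | _, Fwd => false | _, _ => true end.

(* For [u e k f l] as above: some walk edge points from [k] to a neighbouring
   node on the walk outside the strongly connected component of [k]. *)
Definition leaves_sc V (G : dmg V) (u : V) (e : ekind) (k : V)
    (f : ekind) (l : V) : Prop :=
  (e = Bwd /\ u \notin sc G k) \/ (f = Fwd /\ l \notin sc G k).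

Definition sigma_blocked V (G : dmg V) (C : {set V})
    (i : V) (s : seq (ekind * V)) : Prop :=
  [\/ i \in C \/ walk_end i s \in C,
      exists u e k f l,
        [/\ inner i s u e k f l, collider e f & k \notin anS G C]
    | exists u e k f l,
        [/\ inner i s u e k f l, ~~ collider e f, k \in C
          & leaves_sc G u e k f l]].

Definition sigma_separated V (G : dmg V) (A B C : {set V}) : Prop :=
  forall i s, i \in A -> walk_end i s \in B -> is_path G i s ->
    sigma_blocked G C i s.

Definition indep_model (V : finType) := {set {set V} * {set V} * {set V}}.

Definition IM_sigma V (G : dmg V) : indep_model V :=
  [set t | `[< sigma_separated G t.1.1 t.1.2 t.2 >]].

Definition sigma_Markov_equiv V (G1 G2 : dmg V) : Prop :=
  IM_sigma G1 = IM_sigma G2.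

Definition inducing_path V (G : dmg V) (i j : V) (s : seq (ekind * V)) : Prop :=
  [/\ is_path G i s, walk_end i s = j
    & forall u e k f l, inner i s u e k f l ->
        (collider e f -> k \in anS G [set i; j]) /\
        (~~ collider e f -> ~ leaves_sc G u e k f l)].

(** [P (i, j)] is the mark at [j] on the edge between [i] and [j], and [None] if
    there is no such edge.  The edge [i -> j] has a tail at [i] and an arrowhead
    at [j]; an undirected edge has two tails, and [i o-o j] has two circles. *)

Variant mark := Circle | Arrow | Tail.

Definition mark_eqb (x y : mark) : bool :=
  match x, y with
  | Circle, Circle | Arrow, Arrow | Tail, Tail => true
  | _, _ => false
  end.

Lemma mark_eqP : Equality.axiom mark_eqb.
Proof. by case; case; constructor. Qed.

HB.instance Definition _ := hasDecEq.Build mark mark_eqP.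

Definition mgraph (V : finType) := {ffun V * V -> option mark}.

Section MarkedGraphs.
Variables (V : finType) (P : mgraph V).

Definition adj : rel V := fun i j => P (i, j) != None.
Definition directed : rel V :=
  fun i j => (P (i, j) == Some Arrow) && (P (j, i) == Some Tail).
Definition bidirected : rel V :=
  fun i j => (P (i, j) == Some Arrow) && (P (j, i) == Some Arrow).
Definition undirected : rel V :=
  fun i j => (P (i, j) == Some Tail) && (P (j, i) == Some Tail).

Definition dpag_inducing_path (i j : V) (p : seq V) : Prop :=
  [/\ path adj i p, uniq (i :: p), last i p = j
    & forall s1 s2 u k l, i :: p = s1 ++ [:: u, k, l & s2] ->
        [/\ P (u, k) = Some Arrow, P (l, k) = Some Arrow
          & connect directed k i || connect directed k j]].

Record is_dpag : Prop := IsDpag {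
  dpag_sym : symmetric adj;
  dpag_irr : irreflexive adj;
  (* rules out the edge types [i - j], [i -o j] and [i o- j] *)
  dpag_tail : forall i j, P (i, j) = Some Tail -> P (j, i) = Some Arrow;
  dpag_acyclic : forall i j, connect directed i j -> ~~ directed j i;
  dpag_almost_acyclic : forall i j, connect directed i j -> ~~ bidirected j i;
  dpag_maximal : forall i j p, i != j -> ~~ adj i j ->
    ~ dpag_inducing_path i j p }.

Record contains (G : dmg V) : Prop := Contains {
  contains_adj : forall i j, i != j ->
    (adj i j <-> exists s, inducing_path G i j s);
  contains_arrow : forall i j, P (i, j) = Some Arrow -> j \notin an G i;
  contains_tail : forall i j, directed i j -> i \in an G j }.

Definition meek1 (b c : V) : bool :=
  [exists a, [&& directed a b, undirected b c, a != c & ~~ adj a c]].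

Definition meek2 (a c : V) : bool :=
  undirected a c && [exists b, directed a b && directed b c].

Definition meek3 (a b : V) : bool :=
  undirected a b &&
  [exists c, exists d, [&& undirected a c, undirected a d,
     directed c b, directed d b, c != d & ~~ adj c d]].

Definition meek_applicable (a b : V) : bool :=
  [|| meek1 a b, meek2 a b | meek3 a b].

Definition orient (a b : V) : mgraph V :=
  [ffun x => if x == (a, b) then Some Arrow else P x].

Definition undirected_to_circle : mgraph V :=
  [ffun x => if undirected x.1 x.2 then Some Circle else P x].

End MarkedGraphs.

(* Exhaustive application of the rules, one at a time and in any order. *)
Inductive meek_run (V : finType) (P Q : mgraph V) : Prop :=
| meek_stop of P = Q & (forall a b, ~~ meek_applicable P a b)
| meek_step a b of meek_applicable P a b & meek_run (orient P a b) Q.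

(* [i] and [j] form an unordered pair, whence the disjunction; it is redundant
   for the models [IM_sigma G], which are symmetric. *)
Definition separates V (I : indep_model V) (i j : V) (Z : {set V}) : bool :=
  (Z \subset ~: [set i; j]) &&
  ((([set i], [set j], Z) \in I) || (([set j], [set i], Z) \in I)).

Definition pc_adj V (I : indep_model V) (i j : V) : bool :=
  (i != j) && ~~ [exists Z, separates I i j Z].

Definition is_sepset V (I : indep_model V) (S : V -> V -> {set V}) : Prop :=
  (forall i j, S i j = S j i) /\
  (forall i j, i != j -> ~~ pc_adj I i j -> separates I i j (S i j)).

(* The triple is to be oriented as [a -> c <- b]. *)
Definition pc_vstruct V (I : indep_model V) (S : V -> V -> {set V})
    (a c b : V) : bool :=
  [&& pc_adj I a c, pc_adj I c b, a != b, ~~ pc_adj I a b & c \notin S a b].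

(* All v-structures are oriented at once; for an arbitrary model an edge may
   thus get two arrowheads, and is then bidirected. *)
Definition pc_skeleton_vstruct V (I : indep_model V) (S : V -> V -> {set V}) :
    mgraph V :=
  [ffun x =>
    if ~~ pc_adj I x.1 x.2 then None
    else if [exists b, pc_vstruct I S x.1 x.2 b] then Some Arrow
    else Some Tail].

Definition pc_meek_output V (I : indep_model V) (P : mgraph V) : Prop :=
  exists (S : V -> V -> {set V}) (Q : mgraph V),
    [/\ is_sepset I S, meek_run (pc_skeleton_vstruct I S) Q
      & P = undirected_to_circle Q].

(* A mapping computed by the algorithm, for some rule selecting the separating
   sets and some order of application of Meek's rules. *)
Definition pc_meek_mapping V (Phi : indep_model V -> mgraph V) : Prop :=
  forall I, pc_meek_output I (Phi I).

Lemma meek_applicable_undirected (V : finType) (P : mgraph V) a b :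
  meek_applicable P a b -> undirected P a b.
Proof.
by case/or3P => [/existsP[c /and4P[]]|/andP[]|/andP[]].
Qed.

Lemma meek_run_exists (V : finType) (P : mgraph V) : exists Q, meek_run P Q.
Proof.
have [n] := ubnP #|[set x | undirected P x.1 x.2]|.
elim: n P => // n IHn P lePn.
have [/existsP[a /existsP[b ab]]|nab] :=
    boolP [exists a, exists b, meek_applicable P a b]; last first.
  exists P; apply: meek_stop => // a b; apply: contra nab => ab.
  by apply/existsP; exists a; apply/existsP; exists b.
have [|Q rQ] := IHn (orient P a b); last by exists Q; apply: meek_step rQ.
rewrite -ltnS; apply: leq_trans lePn; rewrite ltnS; apply: proper_card.
apply/properP; split.
  apply/subsetP=> -[u v]; rewrite !inE /undirected !ffunE /=.
  by case: ifP => // _; case: ifP => // _; rewrite andbF.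
exists (a, b); first by rewrite inE /= meek_applicable_undirected.
by rewrite inE /undirected !ffunE eqxx.
Qed.

Lemma pc_meek_mapping_exists (V : finType) :
  exists Phi : indep_model V -> mgraph V, pc_meek_mapping Phi.
Proof.
suff ex I : exists P : mgraph V, pc_meek_output I P.
  by have [Phi] := choice ex; exists Phi.
pose S i j := odflt set0 [pick Z | separates I i j Z].
have [Q rQ] := meek_run_exists (pc_skeleton_vstruct I S).
exists (undirected_to_circle Q), S, Q; split=> //; split=> i j.
  rewrite /S; congr odflt; apply: eq_pick => Z.
  by rewrite /separates setUC orbC.
move=> neq_ij; rewrite /pc_adj neq_ij /= negbK => /existsP[Z sepZ].
by rewrite /S; case: pickP => [//|/(_ Z)]; rewrite sepZ.
Qed.

Section Properties.
(* [Psi] is the background knowledge. *)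
Variables (V : finType) (Psi : dmg V -> Prop) (Phi : indep_model V -> mgraph V).

Definition dpag_valued : Prop :=
  forall G, Psi G -> is_dpag (Phi (IM_sigma G)).

Definition sound : Prop :=
  forall G, Psi G -> contains (Phi (IM_sigma G)) G.

Definition arrowhead_complete : Prop :=
  forall G, Psi G -> forall i j, i != j -> adj (Phi (IM_sigma G)) i j ->
    (forall G', Psi G' -> sigma_Markov_equiv G' G -> i \notin an G' j) ->
    Phi (IM_sigma G) (j, i) = Some Arrow.

Definition tail_complete : Prop :=
  forall G, Psi G -> forall i j, i != j -> adj (Phi (IM_sigma G)) i j ->
    (forall G', Psi G' -> sigma_Markov_equiv G' G -> i \in an G' j) ->
    directed (Phi (IM_sigma G)) i j.

Definition Markov_complete : Prop :=
  forall G1 G2, Psi G1 -> Psi G2 ->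
    (sigma_Markov_equiv G1 G2 <-> Phi (IM_sigma G1) = Phi (IM_sigma G2)).

End Properties.

Definition causally_sufficient V (G : dmg V) : Prop :=
  forall i j, ~~ bid G i j.

(* Main.v *)
Require Import Defs.
From mathcomp Require Import all_boot.
From mathcomp Require Import boolp.
Set Implicit Arguments.
Unset Strict Implicit.
Unset Printing Implicit Defensive.

(** The proof transfers the classical theory of CPDAGs of acyclic graphs to
    cyclic ones without acyclifying them.  In a DMG [G] without bidirected edges,
    call [i] a sigma-parent of [j] ([spar]) if [i] lies in the strongly connected
    component of [j] or has a directed edge into it.  This relation need not be
    acyclic, but two properties ([quasi_dag]) make it as good as a DAG: a node
    with a directed path to one of its sigma-parents is a sigma-parent of it, and
    two nodes that are sigma-parents of each other have the same sigma-parents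
    apart from themselves.  Every later argument about a DAG needs no more.

    Three characterizations reduce the statement to the relation [spar G].
    - The sigma-open paths given [C] are the connections, avoiding [C], in the
      moral graph of [spar G] on the ancestors of the endpoints and of [C]
      ([sigma_open_path_mconn]).
    - Two quasi-DAGs with the same skeleton and the same v-structures have the
      same moral connections ([mconn_transfer]); this is the theorem of Verma
      and Pearl.  Hence skeleton and v-structures determine the sigma-Markov
      equivalence class ([sigma_Markov_equivP]).
    - Adjacency in [spar G] is the existence of an inducing path
      ([skel_inducing]), and also the absence of a separating set ([pc_adjE]).
      If [a] and [b] are not adjacent and [c] is a common neighbour, then the
      separating sets of [a] and [b] avoid [c] if both are sigma-parents of [c],
      and contain [c] otherwise ([pc_vstructE]); so the algorithm starts from the
      [pattern] of [spar G], whatever separating sets it selects.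

    Soundness: each arrowhead put by the v-structures or by a rule of Meek is
    strict, that is, [a -> b] implies that [a] is a sigma-parent of [b] and [b] is
    no ancestor of [a] ([meek_strict]).  The DPAG axioms, the containment of [G]
    and the half of the completeness statements that concerns directed edges
    follow.

    Completeness: an edge left undirected must be orientable both ways within the
    equivalence class.  The key fact is that after exhaustive application of the
    rules [a -> b] and [b - c] imply [a -> c] ([directed_absorb]).  So any
    orientation of the undirected edges that creates neither a directed cycle nor
    a v-structure among them can be added to the directed edges without creating
    any elsewhere.  Such orientations come from orders of the nodes in which the
    earlier neighbours of each node form a clique, and such an order can start
    from any node, because by a theorem of Dirac a non-complete chordal graph has
    two non-adjacent simplicial vertices ([dirac], [perfect_order_from]).  Putting
    an endpoint of the edge first gives a DAG with the desired orientation
    ([meek_extension]). *)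

(** * Shortest paths *)

Section InducedPaths.
Variables (T : finType) (e : rel T).

(** Only nodes two steps apart are required to be distinct and non-adjacent;
    this much of an induced path is all that the arguments on v-structures
    along a shortest path use. *)
Fixpoint no_shortcut (x : T) (p : seq T) : bool :=
  if p is y :: p' then
    (if p' is z :: _ then (x != z) && ~~ e x z else true) && no_shortcut y p'
  else true.

Lemma path_shorten x p : path e x p -> ~~ no_shortcut x p ->
  exists q, [/\ path e x q, last x q = last x p & size q < size p].
Proof.
elim: p x => [|y [|z p] IHp] x //.
rewrite [path _ _ _]/= -/(path e y (z :: p)) => /andP[exy eyp].
have -> : no_shortcut x [:: y, z & p] =
    (x != z) && ~~ e x z && no_shortcut y (z :: p).
  by [].
case/nandP=> [/nandP[/negPn/eqP xz|/negPn exz]|/(IHp _ eyp)[q [eq lq sq]]].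
- by exists p; move: eyp => /= /andP[_]; rewrite xz; split=> //=; rewrite ltnW.
- by exists (z :: p); move: eyp => /= /andP[_ ->]; rewrite exz.
by exists (y :: q); rewrite /= exy lq.
Qed.

Lemma no_shortcut_path x p : path e x p ->
  exists q, [/\ path e x q, last x q = last x p & no_shortcut x q].
Proof.
have [n] := ubnP (size p); elim: n p => // n IHn p /ltnSE-ltpn ep.
have [ip|nip] := boolP (no_shortcut x p); first by exists p.
have [q [eq <- sq]] := path_shorten ep nip.
by apply: IHn eq; apply: leq_trans sq ltpn.
Qed.

Lemma connect_no_shortcut x y : connect e x y ->
  exists p, [/\ path e x p, last x p = y & no_shortcut x p].
Proof. by case/connectP=> p /no_shortcut_path[q [? lq ?]] ->; exists q. Qed.
End InducedPaths.

(** * Moral connection, and its invariance *)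

Section Skeleton.
Variables (V : finType) (E : rel V).

Definition skel (a b : V) : bool := E a b || E b a.

Definition vstruct (a c b : V) : bool :=
  [&& a != b, ~~ skel a b, E a c & E b c].

Definition anc (W : {set V}) : {set V} :=
  [set x | [exists w in W, connect E x w]].

(** [u] belongs to the family of [c], the clique that [c] contributes to the
    moral graph. *)
Definition fam (u c : V) : bool := (u == c) || E u c.

Definition moral (W C : {set V}) (u v : V) : bool :=
  [&& u != v, u \in anc W :\: C, v \in anc W :\: C
    & [exists c in anc W, fam u c && fam v c]].

Definition mconn (C : {set V}) (i j : V) : bool :=
  connect (moral (i |: (j |: C)) C) i j.

(** In a DAG the premises of [qd_clique] and [qd_back] never hold.  In general
    the strongly connected components are cliques whose members have the same
    parents, and a v-structure never has two of its nodes in the same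
    component. *)
Record quasi_dag : Prop := QuasiDag {
  qd_irr : irreflexive E;
  qd_clique : forall a b c, E a b -> E b c -> E c b -> a != c -> E a c;
  qd_back : forall a b, E a b -> connect E b a -> E b a }.

Lemma skelC : symmetric skel.
Proof. by move=> a b; rewrite /skel orbC. Qed.

Lemma vstructC a c b : vstruct a c b = vstruct b c a.
Proof. by rewrite /vstruct eq_sym skelC [E a c && _]andbC. Qed.

Lemma ancP (W : {set V}) x :
  reflect (exists2 w, w \in W & connect E x w) (x \in anc W).
Proof. by rewrite inE; apply: exists_inP. Qed.

Lemma mem_anc (W : {set V}) x : x \in W -> x \in anc W.
Proof. by move=> Wx; apply/ancP; exists x. Qed.

Lemma anc_connect (W : {set V}) x y : connect E x y -> y \in anc W -> x \in anc W.
Proof.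
move=> xy /ancP[w Ww yw]; apply/ancP; exists w => //.
exact: connect_trans xy yw.
Qed.

Lemma moralC W C : symmetric (moral W C).
Proof.
move=> u v; rewrite /moral eq_sym; congr (_ && _); rewrite andbCA.
by do 2!congr (_ && _); apply: eq_existsb => c; rewrite [fam u c && _]andbC.
Qed.

Lemma mconnC C i j : mconn C i j = mconn C j i.
Proof. by rewrite /mconn setUCA (sym_connect_sym (moralC _ _)). Qed.
End Skeleton.

Section VermaPearl.
Variables (V : finType) (E E' : rel V).
Hypothesis qE : quasi_dag E.
Hypothesis same_skel : skel E =2 skel E'.
Hypothesis same_vstruct : forall a c b, vstruct E a c b = vstruct E' a c b.

(** If [c] were also a parent of [a], both would have the same parents, among
    them [b], which is not adjacent to [a]. *)
Lemma vstruct_strict a c b : vstruct E a c b -> ~~ E c a.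
Proof.
case/and4P=> nab; rewrite /skel negb_or => /andP[_ nEba] Eac Ebc.
apply: contra nEba => Eca; apply: (qd_clique qE) Ebc Eca Eac _.
by rewrite eq_sym.
Qed.

(** A directed path without shortcuts keeps its direction in [E']: where it
    turned around there would be a v-structure of [E'], hence of [E], in the
    middle of the path.  The node [z] before [c] starts the argument. *)
Lemma no_shortcut_chain p c z : path E c p -> no_shortcut E c p -> E z c -> E' z c ->
  (if p is d :: _ then (z != d) && ~~ skel E z d else true) ->
  connect E' c (last c p).
Proof.
elim: p c z => // d p IHp c z /= /andP[Ecd Edp] /andP[icp idp] Ezc E'zc.
case/andP=> nzd nSzd.
(* Otherwise [c] and [d] have the same parents, and [z] is one of [d]. *)
have nEdc : ~~ E d c.
  apply: contra nSzd => Edc; rewrite /skel.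
  by rewrite (qd_clique qE Ezc Ecd Edc nzd).
have E'cd : E' c d.
  have: skel E' c d by rewrite -same_skel /skel Ecd.
  case/orP=> // E'dc; case/negP: nEdc.
  suff: vstruct E z c d by case/and4P.
  by rewrite same_vstruct /vstruct nzd -same_skel nSzd E'zc.
apply: connect_trans (connect1 E'cd) _; apply: (IHp _ c) => //.
case: p {IHp} Edp icp idp => // d2 p /= /andP[Edd2 _] /andP[ncd2 nEcd2] _.
rewrite ncd2 /skel negb_or nEcd2; apply: contra nEcd2 => Ed2c.
apply: (qd_clique qE Ecd Edd2 _ ncd2); apply: (qd_back qE Edd2).
exact: connect_trans (connect1 Ed2c) (connect1 Ecd).
Qed.

(** Take a shortest directed path from [c] to [W], with second node [d].  If
    some endpoint [x] of the v-structure is not adjacent to [d], then the path is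
    also directed in [E'] by [no_shortcut_chain] for [x -> c -> d], and [c] itself
    does.  Otherwise both endpoints are parents of [d], which then replaces
    [c]. *)
Lemma vstruct_anc (W : {set V}) u c v : vstruct E u c v -> c \in anc E W ->
  exists c', vstruct E u c' v /\ c' \in anc E' W.
Proof.
move=> Vucv /ancP[w Ww /connect_no_shortcut[p [Ecp lp ip]]].
elim: p c Vucv Ecp lp ip => [|d p IHp] c Vucv Ecp lp ip.
  by exists c; split=> //; apply: mem_anc; rewrite [c]lp.
have [nuv nSuv Euc Evc] := and4P Vucv.
have /andP[Ecd Edp] : E c d && path E d p by [].
have idp : no_shortcut E d p by case/andP: ip.
have Vvcu : vstruct E v c u by rewrite vstructC.
have one x y : vstruct E x c y -> skel E x d -> E x d.
  move=> Vxcy /orP[//|Edx]; case/negP: (vstruct_strict Vxcy).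
  have [_ _ Exc _] := and4P Vxcy; apply: (qd_back qE Exc).
  exact: connect_trans (connect1 Ecd) (connect1 Edx).
have two x y : vstruct E x c y -> ~~ skel E x d -> c \in anc E' W.
  move=> Vxcy nSxd; apply/ancP; exists w => //; rewrite -lp.
  have [_ _ Exc _] := and4P Vxcy.
  apply: (no_shortcut_chain Ecp ip Exc).
    by move: Vxcy; rewrite same_vstruct => /and4P[].
  rewrite nSxd andbT; apply: contraL Ecd => /eqP <-.
  exact: vstruct_strict Vxcy.
have [Sud|nSud] := boolP (skel E u d); last first.
  by exists c; split=> //; apply: two nSud; apply: Vucv.
have [Svd|nSvd] := boolP (skel E v d); last first.
  by exists c; split=> //; apply: two nSvd; apply: Vvcu.
apply: (IHp d) => //; rewrite /vstruct nuv nSuv.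
by rewrite (one _ _ Vucv Sud) (one _ _ Vvcu Svd).
Qed.

Variables (W C : {set V}).
Local Notation M := (moral E W C).

(** A marriage of non-adjacent nodes also takes place in [E'], at an ancestor
    of [W], by [vstruct_anc]. *)
Lemma moral_cases u v : M u v ->
  skel E u v \/ exists c, [/\ c \in anc E' W, E' u c & E' v c].
Proof.
case/and4P=> nuv _ _ /exists_inP[c Wc /andP[fuc fvc]].
have [Suv|nSuv] := boolP (skel E u v); [by left | right].
have Euc : E u c.
  case/predU1P: fuc => // uc; rewrite -uc in fvc; case/negP: nSuv.
  by case/predU1P: fvc => [vu|Evu]; [rewrite vu eqxx in nuv | apply/orP; right].
have Evc : E v c.
  case/predU1P: fvc => // vc; case/negP: nSuv; rewrite vc.
  by apply/orP; left.
have [|c' [V' Wc']] := @vstruct_anc W u c v _ Wc.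
  by rewrite /vstruct nuv nSuv Euc.
by exists c'; move: V'; rewrite same_vstruct => /and4P[].
Qed.

Lemma moral_intro u c v : u != v -> u \in anc E W :\: C ->
  v \in anc E W :\: C -> c \in anc E W -> fam E u c -> fam E v c -> M u v.
Proof.
move=> nuv Tu Tv Wc uc vc; apply/and4P; split=> //; apply/exists_inP.
by exists c; rewrite ?uc.
Qed.

Lemma moral_skel u v : u != v -> u \in anc E W :\: C ->
  v \in anc E W :\: C -> skel E u v -> M u v.
Proof.
move=> nuv Tu Tv; have [[Wu _] [Wv _]] := (setDP Tu, setDP Tv).
case/orP=> [Euv|Evu]; [apply: (moral_intro (c := v))|apply: (moral_intro (c := u))];
  by rewrite // /fam ?eqxx ?Euv ?Evu ?orbT.
Qed.

(** A collider of [E'] at [z] would be one of [E], by the shared v-structures,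
    and [z] would marry [y] and [t] in the moral graph of [E]. *)
Lemma moral_no_collider y z t : M y z -> M z t -> y != t -> ~~ M y t ->
  E' y z -> E' t z -> False.
Proof.
move=> /and4P[_ Ty Tz _] /and4P[_ _ Tt _] nyt /negP nM E'yz E'tz.
have [Syt|nSyt] := boolP (skel E y t); first by apply/nM/moral_skel.
have /and4P[_ _ Eyz Etz]: vstruct E y z t.
  by rewrite same_vstruct /vstruct nyt -same_skel nSyt E'yz.
have [Wz _] := setDP Tz.
by apply/nM/(moral_intro nyt Ty Tt Wz); rewrite /fam ?Eyz ?Etz orbT.
Qed.

(** Once an edge of a shortest moral path points forward in [E'], so do the
    next ones, by [moral_no_collider], until the path ends in [W] or reaches a
    marriage; both are ancestors of [W] in [E']. *)
Lemma moral_fwd p y z : E' y z -> M y z -> path M z p ->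
  no_shortcut M y (z :: p) -> last z p \in W -> z \in anc E' W.
Proof.
elim: p y z => [|t p IHp] y z E'yz Myz; first by move=> _ _; apply: mem_anc.
move=> /= /andP[Mzt Mtp] /andP[/andP[nyt nMyt] iztp] lW.
have [Szt|[c [Wc E'zc _]]] := moral_cases Mzt; last first.
  exact: anc_connect (connect1 E'zc) Wc.
suff E'zt : E' z t.
  exact: anc_connect (connect1 E'zt) (IHp _ _ E'zt Mzt Mtp iztp lW).
have : skel E' z t by rewrite -same_skel.
case/orP=> // E'tz.
by have := moral_no_collider Myz Mzt nyt nMyt E'yz E'tz.
Qed.

(** The only thing that could fail in the moral graph of [E'] is that some node
    of the path is not an ancestor of [W] there.  But each node points in [E'] to
    an ancestor: backward, forward along [moral_fwd], or to the child of a
    marriage. *)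
Lemma moral_transfer_path p x : x \in anc E' W -> path M x p -> no_shortcut M x p ->
  last x p \in W -> path (moral E' W C) x p.
Proof.
elim: p x => //= y p IHp x W'x /andP[Mxy Myp] ixyp lW.
have W'y : y \in anc E' W.
  have [Sxy|[c [Wc _ E'yc]]] := moral_cases Mxy; last first.
    exact: anc_connect (connect1 E'yc) Wc.
  have : skel E' x y by rewrite -same_skel.
  case/orP=> [E'xy|E'yx]; first exact: (moral_fwd E'xy Mxy Myp).
  exact: anc_connect (connect1 E'yx) W'x.
have iyp : no_shortcut M y p by case/andP: ixyp.
rewrite IHp // andbT.
have /and4P[nxy /setDP[_ nCx] /setDP[_ nCy] _] := Mxy.
apply/and4P; split; [by [] | exact/setDP | exact/setDP | apply/exists_inP].
have [Sxy|[c [Wc E'xc E'yc]]] := moral_cases Mxy; last first.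
  by exists c; rewrite // /fam E'xc E'yc !orbT.
move: Sxy; rewrite same_skel => /orP[E'xy|E'yx]; [exists y | exists x] => //;
  by rewrite /fam eqxx ?E'xy ?E'yx ?orbT.
Qed.
End VermaPearl.

(** The theorem of Verma and Pearl for quasi-DAGs: skeleton and v-structures
    determine the separations. *)
Theorem mconn_transfer (V : finType) (E E' : rel V) (C : {set V}) (i j : V) :
  quasi_dag E -> skel E =2 skel E' ->
  (forall a c b, vstruct E a c b = vstruct E' a c b) ->
  mconn E C i j -> mconn E' C i j.
Proof.
move=> qE sS sV /connect_no_shortcut[p [Mp lp ip]].
apply/connectP; exists p; last by rewrite lp.
apply: (moral_transfer_path qE sS sV _ Mp ip).
  by rewrite mem_anc ?setU11.
by rewrite lp !inE eqxx orbT.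
Qed.

(** * Sigma-parents *)

Section SigmaParents.
Variables (V : finType) (G : dmg V).
Local Notation D := (dir G).

(** The parents of [b] in the acyclifications of [G], over all orders of the
    nodes inside the strongly connected components. *)
Definition spar (a b : V) : bool :=
  (a != b) && [exists k in sc G b, (a == k) || D a k].

Lemma mem_sc a b : (a \in sc G b) = connect D a b && connect D b a.
Proof. by rewrite !inE. Qed.

Lemma sc_refl a : a \in sc G a.
Proof. by rewrite mem_sc connect0. Qed.

Lemma sc_sym a b : (a \in sc G b) = (b \in sc G a).
Proof. by rewrite !mem_sc andbC. Qed.

Lemma sc_trans b a c : a \in sc G b -> b \in sc G c -> a \in sc G c.
Proof.
rewrite !mem_sc => /andP[ab ba] /andP[bc cb].
by rewrite (connect_trans ab bc) (connect_trans cb ba).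
Qed.

Lemma famE a b : fam spar a b = [exists k in sc G b, (a == k) || D a k].
Proof.
rewrite /fam /spar; have [->|//] := eqVneq a b.
by apply/esym/exists_inP; exists b; rewrite ?sc_refl ?eqxx.
Qed.

Lemma fam_dir a b : D a b -> fam spar a b.
Proof.
by move=> ab; rewrite famE; apply/exists_inP; exists b; rewrite ?sc_refl ?ab ?orbT.
Qed.

Lemma fam_in_sc a b : a \in sc G b -> fam spar a b.
Proof. by move=> ab; rewrite famE; apply/exists_inP; exists a; rewrite ?eqxx. Qed.

Lemma fam_refl a : fam spar a a.
Proof. exact/fam_in_sc/sc_refl. Qed.

Lemma fam_sc a b c : fam spar a b -> b \in sc G c -> fam spar a c.
Proof.
rewrite !famE => /exists_inP[k kb ak] bc; apply/exists_inP; exists k => //.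
exact: sc_trans kb bc.
Qed.

Lemma fam_spar a b : a != b -> fam spar a b = spar a b.
Proof. by rewrite /fam => /negPf->. Qed.

Lemma spar_neq a b : spar a b -> a != b.
Proof. by case/andP. Qed.

Lemma spar_fam a b : spar a b -> fam spar a b.
Proof. by rewrite /fam => ->; rewrite orbT. Qed.

Lemma dir_spar a b : D a b -> spar a b.
Proof.
move=> ab; rewrite -fam_spar ?fam_dir //.
by apply: contraTneq ab => ->; rewrite dir_irr.
Qed.

Lemma fam_connect a b : fam spar a b -> connect D a b.
Proof.
rewrite famE => /exists_inP[k]; rewrite mem_sc => /andP[kb _].
by case/predU1P=> [->//|/connect1 ak]; apply: connect_trans ak kb.
Qed.

Lemma connect_spar : connect spar =2 connect D.
Proof.
move=> a b; apply/idP/idP; apply: connect_sub => {}a {}b.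
  by move/spar_fam/fam_connect.
by move/dir_spar/connect1.
Qed.

Lemma fam_back a b : fam spar a b -> connect D b a -> a \in sc G b.
Proof. by move=> /fam_connect ab ba; rewrite mem_sc ab. Qed.

Lemma quasi_spar : quasi_dag spar.
Proof.
split=> [a|a b c|a b].
- by rewrite /spar eqxx.
- move=> Eab Ebc Ecb nac; rewrite -fam_spar //.
  apply: fam_sc (spar_fam Eab) _; apply: fam_back (spar_fam Ebc) _.
  exact/fam_connect/spar_fam.
move=> Eab; rewrite connect_spar => ba.
rewrite -fam_spar; last by rewrite eq_sym spar_neq.
by apply: fam_in_sc; rewrite sc_sym; apply: fam_back (spar_fam Eab) ba.
Qed.

Lemma anSE (I : {set V}) : anS G I = anc spar I.
Proof.
apply/setP=> x; apply/bigcupP/ancP=> -[w Iw xw]; exists w => //.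
  by rewrite connect_spar; rewrite inE in xw.
by rewrite inE -connect_spar.
Qed.

End SigmaParents.

(** * The moralization criterion for sigma-separation *)

Section OpenWalks.
Variables (V : finType) (G : dmg V) (C : {set V}).
Hypothesis csG : causally_sufficient G.
Local Notation D := (dir G).

(** A sigma-open walk, seen as a walk on pairs of a node and a flag, because
    whether the walk may go on from a node depends on the preceding edge.  The
    flag tells that the edge just traversed has a tail at the node, or that the
    walk starts there; without the flag the node must be a collider, hence in
    [anS G C], when the walk leaves it against an edge.  Each edge out of a node
    of [C] has to stay in its strongly connected component; the step that
    traverses the edge checks this, in either direction. *)
Definition open_step (p q : V * bool) : bool :=
  if q.2 then [&& D q.1 p.1, p.2 || (p.1 \in anS G C)
                & (q.1 \notin C) || (p.1 \in sc G q.1)]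
  else D p.1 q.1 && ((p.1 \notin C) || (q.1 \in sc G p.1)).

Definition sigma_open (i : V) (s : seq (ekind * V)) : Prop :=
  forall u e k f l, inner i s u e k f l ->
    (collider e f -> k \in anS G C) /\
    (~~ collider e f -> k \in C -> ~ leaves_sc G u e k f l).

Lemma inner_cons (i : V) e y s u e' k f l :
  inner y s u e' k f l -> inner i ((e, y) :: s) u e' k f l.
Proof. by case=> s1 [s2 [-> ->]]; exists ((e, y) :: s1), s2. Qed.

Lemma inner_head (i : V) e k f l s : inner i [:: (e, k), (f, l) & s] i e k f l.
Proof. by exists [::], s. Qed.

(** The part of the condition [sigma_open] at [x] that involves the edge leaving
    [x]; the flag [t] stands for the edge that enters it. *)
Definition entry_ok (x : V) (t : bool) (s : seq (ekind * V)) : bool :=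
  match s with
  | [::] => true
  | (Fwd, y) :: _ => (x \notin C) || (y \in sc G x)
  | _ => t || (x \in anS G C)
  end.

Lemma sigma_open_steps s x t : is_walk G x s -> walk_end x s \notin C ->
    sigma_open x s -> entry_ok x t s ->
  exists b, connect open_step (x, t) (walk_end x s, b).
Proof.
elim: s x t => [|[f y] s IHs] x t /=; first by exists t.
move=> /andP[xy ys] Cend os first_ok.
have os' : sigma_open y s by move=> *; apply: os; apply: inner_cons; eassumption.
pose t' := if f is Fwd then false else true.
suff [xyt rest_ok] : open_step (x, t) (y, t') /\ entry_ok y t' s.
  have [b yb] := IHs y t' ys Cend os' rest_ok.
  by exists b; apply: connect_trans (connect1 xyt) yb.
case: f xy first_ok @t' os Cend => /= xy first_ok os Cend; rewrite /open_step /=.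
- rewrite xy first_ok; split=> //.
  case: s {IHs os' Cend} ys os => // -[f2 z] s /= /andP[yz _] os.
  have [oc onc] := os _ _ _ _ _ (inner_head x Fwd y f2 z s).
  case: f2 yz oc onc {os} => /= [yz _ onc|yz oc _|yz]; last first.
  + by rewrite (negPf (csG _ _)) in yz.
  + exact: oc.
  case: (boolP (y \in C)) => //= Cy; apply: contraT => nz.
  by case: (onc isT Cy); right.
- rewrite xy first_ok /=.
  case: s {IHs os'} ys os Cend => [|[f2 z] s] /= ys os Cend.
    by rewrite Cend.
  have [_ onc] := os _ _ _ _ _ (inner_head x Bwd y f2 z s).
  have {}onc := onc isT.
  split.
    case: (boolP (y \in C)) => //= Cy; apply: contraT => nx.
    by case: (onc Cy); left.
  case: f2 ys os Cend onc => //= _ _ _ onc.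
  case: (boolP (y \in C)) => //= Cy; apply: contraT => nz.
  by case: (onc Cy); right.
by rewrite (negPf (csG _ _)) in xy.
Qed.

Lemma inner_consP (i : V) e y s u e' k f l :
  inner i ((e, y) :: s) u e' k f l ->
  [/\ u = i, e' = e, k = y & exists s', s = (f, l) :: s']
  \/ inner y s u e' k f l.
Proof.
case=> [[|[e1 y1] s1] [s2 [eqs ->]]]; case: eqs => -> -> ->.
  by left; split=> //; exists s2.
by right; exists s1, s2.
Qed.

Definition walk_of (q : seq (V * bool)) : seq (ekind * V) :=
  [seq (if z.2 then Bwd else Fwd, z.1) | z <- q].

Lemma unzip2_walk_of q : unzip2 (walk_of q) = unzip1 q.
Proof. by rewrite /unzip2 -map_comp. Qed.

Lemma walk_of_is_walk p q : path open_step p q -> is_walk G p.1 (walk_of q).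
Proof.
elim: q p => //= -[y t] q IHq p /andP[pyt /IHq->]; rewrite andbT.
by case: t pyt => /andP[].
Qed.

Lemma walk_of_sigma_open p q : path open_step p q -> sigma_open p.1 (walk_of q).
Proof.
elim: q p => [|[y t] q IHq] p /=.
  by move=> _ u e k f l [[|? ?] [s2 []]].
move=> /andP[pyt yq] u e k f l /inner_consP[[-> -> -> [s']]|]; last exact: (IHq _ yq).
case: q {IHq} yq => //= -[z t'] q /andP[ytz _] [<- <- _].
move: pyt ytz; rewrite /open_step /leaves_sc; case: t; case: t' => //=.
- move=> /and3P[_ _ yp] _; split=> // _ Cy [[_]|[//]].
  by rewrite Cy /= in yp; rewrite yp.
- move=> /and3P[_ _ yp] /andP[_ yz]; split=> // _ Cy; rewrite Cy /= in yp yz.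
  by case=> -[_]; rewrite ?yp ?yz.
- by move=> _ /and3P[].
move=> _ /andP[_ yz]; split=> // _ Cy; rewrite Cy /= in yz.
by case=> [[]|[_]] //; rewrite yz.
Qed.

(** A walk that arrives with a tail at its last node after starting along an
    arrowhead must turn at some collider, to which [x] has a directed path up to
    the first turn. *)
Lemma collider_ahead x q y :
  path open_step (x, false) q -> last (x, false) q = (y, true) ->
  x \in anS G C.
Proof.
elim: q x => [|[z [|]] q IHq] x //=; first by case/andP=> /and3P[].
case/andP=> /andP[/= xz _] zq lq; have:= IHq _ zq lq.
by rewrite anSE; apply: anc_connect; rewrite connect_spar connect1.
Qed.

(** A walk that visits [x] twice can skip the part between the visits.  Only one
    case is not obvious: [x] is first entered by an arrowhead and later by a tail,
    and is then left against an edge, so that the shortcut makes [x] a collider.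
    Then [collider_ahead] applies to the part skipped. *)
Lemma open_steps_shorten p q : path open_step p q -> ~~ uniq (unzip1 (p :: q)) ->
  exists q', [/\ path open_step p q', (last p q').1 = (last p q).1
    & size q' < size q].
Proof.
elim: q p => // r q IHq p; rewrite [path _ _ _]/= => /andP[pr rq].
have [urq|/(IHq _ rq)[q' [rq' lq' sq']] _] := boolP (uniq (unzip1 (r :: q)));
  last by exists (r :: q'); rewrite /= pr.
rewrite (_ : unzip1 [:: p, r & q] = p.1 :: unzip1 (r :: q)) // cons_uniq urq.
rewrite andbT => /negPn/mapP[[x t'] rx]; case: p pr => px t pr.
rewrite [(px, t).1]/= [(x, t').1]/= => epx.
have: path open_step (x, t) (r :: q) by rewrite -epx /= pr.
rewrite epx; move: (r :: q) rx => w xw {px pr epx}.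
case/splitPr: xw => q1 q2; rewrite cat_path last_cat size_cat /= addnS.
case/and3P=> pq1 q1x xq2; exists q2; split=> //; last first.
- by rewrite ltnS leq_addl.
- by case: q2 xq2.
case: q2 xq2 => // -[y ty] q2 /= /andP[xy ->]; rewrite andbT.
move: xy; rewrite /open_step /=; case: ty => //= /and3P[-> xa ->]; rewrite andbT /=.
case: t pq1 q1x => //= pq1 q1x; case: t' xa q1x => //= _ q1x.
apply: (@collider_ahead x (rcons q1 (x, true)) x).
  by rewrite rcons_path pq1.
by rewrite last_rcons.
Qed.

Lemma open_steps_uniq p q : path open_step p q -> exists q',
  [/\ path open_step p q', (last p q').1 = (last p q).1 & uniq (unzip1 (p :: q'))].
Proof.
have [n] := ubnP (size q); elim: n q => // n IHn q /ltnSE-ltqn pq.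
have [uq|nuq] := boolP (uniq (unzip1 (p :: q))); first by exists q.
have [q' [pq' <- sq']] := open_steps_shorten pq nuq.
by apply: IHn pq'; apply: leq_trans sq' ltqn.
Qed.

(** Restricting to paths loses nothing, by [open_steps_shorten]. *)
Lemma sigma_open_pathP i j : i \notin C -> j \notin C ->
  (exists s, [/\ is_path G i s, walk_end i s = j & sigma_open i s]) <->
  (exists b, connect open_step (i, true) (j, b)).
Proof.
move=> nCi nCj; split=> [[s [/andP[ws _] lj os]]|[b /connectP[q pq lq]]].
  rewrite -lj; apply: sigma_open_steps => //; first by rewrite lj.
  by case: s {ws lj os} => // -[[] y] s //=; rewrite nCi.
have [q' [pq' lq' uq']] := open_steps_uniq pq; exists (walk_of q'); split.
- by rewrite /is_path (walk_of_is_walk pq') /walk_nodes unzip2_walk_of.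
- by rewrite /walk_end unzip2_walk_of (last_map fst q' (i, true)) lq' -lq.
exact: (walk_of_sigma_open pq').
Qed.

Local Notation E := (spar G).

Section MoralOfSteps.
Variables (i j : V) (b : bool).
Hypotheses (nCi : i \notin C) (nCj : j \notin C).
Local Notation W := (i |: (j |: C)).
Local Notation M := (moral E W C).

Lemma anSC_anc x : x \in anS G C -> x \in anc E W.
Proof.
by rewrite anSE => /ancP[w Cw xw]; apply/ancP; exists w; rewrite // !inE Cw !orbT.
Qed.

Lemma dir_anc x y : D x y -> y \in anc E W -> x \in anc E W.
Proof. by move=> xy; apply: anc_connect; rewrite connect_spar connect1. Qed.

(** From a node entered by an arrowhead, the walk follows directed edges until
    a collider or its end. *)
Lemma arrow_anc x q : path open_step (x, false) q -> last (x, false) q = (j, b) ->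
  x \in anc E W.
Proof.
elim: q x => [|[z [|]] q IHq] x /=.
- by move=> _ [-> _]; rewrite mem_anc // !inE eqxx orbT.
- by case/andP=> /and3P[_ /anSC_anc].
by case/andP=> /andP[xz _] zq lq; apply: dir_anc xz (IHq _ zq lq).
Qed.

(** Consecutive nodes of a sigma-open walk that are in [C] lie in one strongly
    connected component, and the nodes outside [C] just before and after them
    belong to its family.  So an invariant of the walk is that some node [u]
    outside [C], connected to [i], belongs to the family of the current node. *)
Definition anchored (x : V) : Prop :=
  exists u, [/\ u \notin C, u \in anc E W, connect M i u & fam E u x].

Lemma anchored_connect x : anchored x -> x \notin C -> x \in anc E W ->
  connect M i x.
Proof.
case=> u [nCu Wu iu ux] nCx Wx; have [<-//|nux] := eqVneq u x.
apply: connect_trans iu (connect1 _).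
by apply: (moral_intro nux _ _ Wx ux); rewrite ?fam_refl // in_setD ?nCu ?nCx.
Qed.

Lemma anchored_sc x y : anchored x -> x \in sc G y -> anchored y.
Proof.
by case=> u [nCu Wu iu ux] xy; exists u; split=> //; apply: fam_sc ux xy.
Qed.

Lemma anchored_self x : x \notin C -> x \in anc E W -> connect M i x -> anchored x.
Proof. by move=> nCx Wx ix; exists x; rewrite fam_refl. Qed.

Lemma anchored_path p q : path open_step p q -> last p q = (j, b) ->
  anchored p.1 -> p.1 \in anc E W -> anchored j /\ j \in anc E W.
Proof.
elim: q p => [|[y t] q IHq] [x t0] /=; first by move=> _ [-> _].
move=> /andP[xy yq] lq ax Wx; suff [ay Wy] : anchored y /\ y \in anc E W.
  exact: IHq yq lq ay Wy.
have Wy : y \in anc E W.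
  case: t xy yq lq => [/and3P[/= yx _ _] _ _|_]; last exact: arrow_anc.
  exact: dir_anc yx Wx.
split=> //; case: t xy {yq lq} => /=.
  case/and3P=> /= yx _ /orP[nCy|]; last exact: anchored_sc.
  apply: anchored_self => //; case: (ax) => u [nCu Wu iu ux].
  have [<-//|nuy] := eqVneq u y; apply: connect_trans iu (connect1 _).
  apply: (moral_intro nuy _ _ Wx ux); rewrite ?in_setD ?nCu ?nCy //.
  exact: fam_dir.
case/andP=> /= dxy /orP[nCx|yx]; last by apply: anchored_sc ax _; rewrite sc_sym.
exists x; split=> //; first exact: anchored_connect.
exact: fam_dir.
Qed.

Lemma open_steps_mconn : connect open_step (i, true) (j, b) -> mconn E C i j.
Proof.
case/connectP=> q pq lq; have Wi : i \in anc E W by rewrite mem_anc // !inE eqxx.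
have [|//|aj Wj] := anchored_path pq (esym lq); first exact: anchored_self.
exact: anchored_connect aj nCj Wj.
Qed.
End MoralOfSteps.

Section StepsOfMoral.
Variables i j : V.
Local Notation W := (i |: (j |: C)).
Local Notation reach := (fun x => exists t, connect open_step (i, true) (x, t)).

Lemma sub_anS x : x \notin anS G C -> x \notin C.
Proof. by apply: contra => Cx; rewrite anSE mem_anc. Qed.

Lemma anS_dir x y : D x y -> x \notin anS G C -> y \notin anS G C.
Proof.
move=> xy; apply: contra; rewrite anSE; apply: anc_connect.
by rewrite connect_spar connect1.
Qed.

(** Outside the ancestors of [C] directed paths avoid [C], so that the walk may
    restart from [i] and arrive at [x] with a tail. *)
Lemma climb x : x \notin anS G C -> connect D x i ->
  connect open_step (i, true) (x, true).
Proof.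
move=> + /connectP[p]; elim: p x => [|y p IHp] x nx /= => [_ ->|] //.
case/andP=> xy yp lp; have iy := IHp y (anS_dir xy nx) yp lp.
apply: connect_trans iy (connect1 _).
by rewrite /open_step /= xy (sub_anS nx).
Qed.

Lemma descend x : x \notin anS G C -> connect D x j -> reach x -> reach j.
Proof.
move=> + /connectP[p]; elim: p x => [|y p IHp] x nx /= => [_ ->|] //.
case/andP=> xy yp lp [t ix]; apply: IHp (anS_dir xy nx) yp lp _.
exists false; apply: connect_trans ix (connect1 _).
by rewrite /open_step /= xy (sub_anS nx).
Qed.

(** Directed edges inside a strongly connected component never block, even at
    nodes of [C]. *)
Lemma reach_sc x y : y \in sc G x -> reach x -> reach y.
Proof.
rewrite mem_sc => /andP[yx /connectP[p]].
elim: p x yx => [|z p IHp] x yx /= => [_ ->|] //.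
case/andP=> xz zp lp [t ix].
have zy : connect D z y by apply/connectP; exists p.
have yz := connect_trans yx (connect1 xz).
apply: (IHp z yz zp lp); exists false; apply: connect_trans ix (connect1 _).
by rewrite /open_step /= xz mem_sc (connect1 xz) (connect_trans zy yx) orbT.
Qed.

(** A moral path may turn a node of the walk into a collider.  This is harmless
    for an ancestor of [C].  For an ancestor of [i] the walk is replaced by one
    that arrives with a tail, and for an ancestor of [j] it is cut short by a
    directed path to [j]. *)
Lemma reach_or_done x : reach x -> x \in anc E W ->
  [\/ connect open_step (i, true) (x, true), x \in anS G C | reach j].
Proof.
have [Cx|nCx] := boolP (x \in anS G C); first by constructor 2.
move=> ix /ancP[w]; rewrite !inE connect_spar => /or3P[/eqP->|/eqP->|Cw] xw.
- by constructor 1; apply: climb.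
- by constructor 3; apply: descend ix.
by case/negP: nCx; rewrite anSE; apply/ancP; exists w; rewrite ?connect_spar.
Qed.

Lemma reach_moral x y : moral E W C x y -> reach x -> reach y \/ reach j.
Proof.
case/and4P=> _ /setDP[_ nCx] /setDP[_ nCy] /exists_inP[c Wc].
rewrite !famE => /andP[/exists_inP[k kc xk] /exists_inP[k' k'c yk']] ix.
have ik : reach k.
  case/predU1P: xk => [<-//|xk]; case: ix => t ix; exists false.
  by apply: connect_trans ix (connect1 _); rewrite /open_step /= xk nCx.
have {ik}ik' : reach k' by apply: reach_sc ik; apply: sc_trans k'c _; rewrite sc_sym.
case/predU1P: yk' => [->|yk']; first by left.
have Wk' : k' \in anc E W.
  by apply: anc_connect Wc; move: k'c; rewrite connect_spar mem_sc => /andP[].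
suff: (exists t, connect open_step (i, true) (k', t) /\ t || (k' \in anS G C)) \/
    reach j.
  case=> [[t [ikt ok]]|]; [left; exists true | by right].
  by apply: connect_trans ikt (connect1 _); rewrite /open_step /= yk' ok nCy.
case: (reach_or_done ik' Wk') => [ikt|Ck'|]; last by right.
  by left; exists true.
by left; case: ik' => t ik'; exists t; rewrite Ck' orbT.
Qed.

Lemma mconn_open_steps : mconn E C i j ->
  exists b, connect open_step (i, true) (j, b).
Proof.
suff aux p x : reach x -> path (moral E W C) x p -> j = last x p -> reach j.
  by case/connectP=> p; apply: aux; exists true.
elim: p x => [|y p IHp] x ix /= => [_ ->|] //.
case/andP=> xy yp lp; case: (reach_moral xy ix) => // iy.
exact: IHp iy yp lp.
Qed.
End StepsOfMoral.

(** The moralization criterion for sigma-separation. *)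
Theorem sigma_open_path_mconn i j : i \notin C -> j \notin C ->
  (exists s, [/\ is_path G i s, walk_end i s = j & sigma_open i s]) <->
  mconn E C i j.
Proof.
move=> nCi nCj; rewrite (sigma_open_pathP nCi nCj); split=> [[b]|].
  exact: open_steps_mconn.
exact: mconn_open_steps.
Qed.
End OpenWalks.

Lemma sigma_separatedP (V : finType) (G : dmg V) (A B C : {set V}) :
  causally_sufficient G ->
  sigma_separated G A B C <-> forall i j, i \in A -> j \in B ->
    i \notin C -> j \notin C -> ~~ mconn (spar G) C i j.
Proof.
move=> csG; split=> [sep i j Ai Bj nCi nCj|sep i s Ai Bj ps].
  apply/negP=> /(sigma_open_path_mconn csG nCi nCj)[s [ps lsj os]].
  have [] := sep i s Ai _ ps; first by rewrite lsj.
  - by rewrite lsj => -[] Cx; [case/negP: nCi | case/negP: nCj].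
  - by case=> u [e [k [f [l [/os[/[swap] _ h] /h ->]]]]].
  by case=> u [e [k [f [l [/os[_ h] /h/[apply]]]]]].
apply: contrapT => nb.
have nCi : i \notin C by apply/negP=> Ci; apply: nb; constructor 1; left.
have nCj : walk_end i s \notin C by apply/negP=> Cj; apply: nb; constructor 1; right.
case/negP: (sep i _ Ai Bj nCi nCj); apply/(sigma_open_path_mconn csG nCi nCj).
exists s; split=> // u e k f l iuv; split=> [col|ncol Ck lv].
  by apply: contraT => nk; case: nb; constructor 2; exists u, e, k, f, l.
by case: nb; constructor 3; exists u, e, k, f, l.
Qed.

(** * Inducing paths *)

Section InducingPaths.
Variables (V : finType) (G : dmg V).
Hypothesis csG : causally_sufficient G.
Local Notation D := (dir G).
Local Notation E := (spar G).

Section Adjacent.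
Variables i j : V.

Definition inducing_walk (x : V) (s : seq (ekind * V)) : Prop :=
  forall u e k f l, inner x s u e k f l ->
    (collider e f -> k \in anS G [set i; j]) /\
    (~~ collider e f -> ~ leaves_sc G u e k f l).

Lemma inducing_behead x e y s : inducing_walk x ((e, y) :: s) -> inducing_walk y s.
Proof. by move=> iw u e' k f l /(inner_cons x e)/iw. Qed.

Lemma stays_fwd x e y z s :
  inducing_walk x [:: (e, y), (Fwd, z) & s] -> z \in sc G y.
Proof.
move=> iw; have [_ nl] := iw _ _ _ _ _ (inner_head x e y Fwd z s).
by apply: contraT => nz; case: nl; [case: (e) | right].
Qed.

Lemma stays_bwd x y f z s :
  inducing_walk x [:: (Bwd, y), (f, z) & s] -> x \in sc G y.
Proof.
move=> iw; have [_ nl] := iw _ _ _ _ _ (inner_head x Bwd y f z s).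
by apply: contraT => nz; case: nl => //; left.
Qed.

(** A non-collider inside an inducing path cannot leave its strongly connected
    component, so that an edge between two components starts at an endpoint of the
    path.  Hence the walk stays in the component of [x] until its last edge. *)
Lemma inducing_fam_end x s : is_walk G x s -> inducing_walk x s ->
  (forall y s', s = (Fwd, y) :: s' -> y \in sc G x) -> fam E (walk_end x s) x.
Proof.
elim: s x => [|[f y] s IHs] x /=; first by rewrite fam_refl.
move=> /andP[xy ys] iw sc_fwd.
have yend : fam E (walk_end y s) y.
  apply: IHs => // [|z s' def_s]; first exact: inducing_behead iw.
  by rewrite def_s in iw; apply: stays_fwd iw.
rewrite (_ : walk_end x _ = walk_end y s) //.
case: f xy iw sc_fwd => /= xy iw sc_fwd.
- exact: fam_sc yend (sc_fwd _ _ erefl).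
- case: s {ys IHs sc_fwd} yend iw => [|[f z] s] yend iw; first exact: fam_dir.
  by apply: fam_sc yend _; rewrite sc_sym; apply: stays_bwd iw.
by rewrite (negPf (csG _ _)) in xy.
Qed.

(** The directed edges after an arrowhead at [x] lead to a collider or to
    [j]. *)
Lemma inducing_anc u x s : is_walk G x s -> walk_end x s = j ->
  inducing_walk u ((Fwd, x) :: s) -> x \in anS G [set i; j].
Proof.
elim: s u x => [|[f y] s IHs] u x /=.
  by move=> _ <- _; rewrite anSE mem_anc // !inE eqxx orbT.
move=> /andP[xy ys] ej iw.
have [col _] := iw _ _ _ _ _ (inner_head u Fwd x f y s).
case: f xy ej iw col => /= xy ej iw col; [|exact: col..].
have: y \in anS G [set i; j] by apply: (IHs x) => //; apply: inducing_behead iw.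
by rewrite !anSE; apply: anc_connect; rewrite connect_spar connect1.
Qed.

(** Both endpoints belong to the family of the second node [x], by
    [inducing_fam_end].  They are adjacent as soon as one of them is in the
    component of [x]; if [i] has an edge into [x], then [x] is an ancestor of [i] or
    [j], by [inducing_anc], and this endpoint is in the component.  If [x] has an
    edge into [i], then [x] is [j], or [i] is in the component. *)
Lemma inducing_skel s : i != j -> inducing_path G i j s -> skel E i j.
Proof.
move=> nij [/andP[ws _] ej iw]; have {}iw : inducing_walk i s by [].
have fam_skel : fam E i j || fam E j i -> skel E i j.
  by rewrite /skel (fam_spar _ nij) fam_spar 1?eq_sym.
case: s ws ej iw => [_ /= eij|[f x] s /= /andP[ix xs] ej iw].
  by rewrite -eij eqxx in nij.
have jx : fam E j x.
  rewrite -ej -[walk_end i _]/(walk_end x s).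
  apply: inducing_fam_end => //; first exact: inducing_behead iw.
  by move=> y s' def_s; rewrite def_s in iw; apply: stays_fwd iw.
case: f ix ej iw => /= ix ej iw.
- have: x \in anS G [set i; j] by apply: inducing_anc iw.
  rewrite anSE => /ancP[w]; rewrite !inE connect_spar => /orP[]/eqP-> xw.
    apply/fam_skel/orP; right; apply: fam_sc jx _; rewrite sc_sym.
    exact: fam_back (fam_dir ix) xw.
  apply/fam_skel/orP; left; apply: fam_sc (fam_dir ix) _; rewrite sc_sym.
  exact: fam_back jx xw.
- apply/fam_skel/orP; right; case: s xs ej iw => [|[f z] s] xs ej iw.
    by rewrite -ej; apply: fam_dir.
  by apply: fam_sc jx _; rewrite sc_sym; apply: stays_bwd iw.
by rewrite (negPf (csG _ _)) in ix.
Qed.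
End Adjacent.

Lemma inner_map e0 (i : V) p u e k f l : inner i [seq (e0, y) | y <- p] u e k f l ->
  [/\ e = e0, f = e0 & exists p1 p2, i :: p = p1 ++ [:: u, k, l & p2]].
Proof.
elim: p i => [|y p IHp] i /=; first by case=> [[|? ?] [? []]].
case/inner_consP=> [[-> -> -> [s']]|/IHp[-> -> [p1 [p2 def_p]]]].
  by case: p {IHp} => //= z p [<- <- _]; split=> //; exists [::], p.
by split=> //; exists (i :: p1), p2; rewrite def_p.
Qed.

Lemma mem_triple (i a b c : V) p p1 p2 :
  i :: p = p1 ++ [:: a, b, c & p2] -> b \in p /\ c \in p.
Proof.
by case: p1 => [|y p1] [_ ->]; rewrite !(mem_cat, inE) !eqxx !orbT.
Qed.

(** All nodes after [i] are in the component of [j], which makes the path and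
    its reverse inducing. *)
Lemma spar_path i j : spar G i j -> exists p,
  [/\ path D i p, last i p = j, uniq (i :: p) & {in p, forall x, x \in sc G j}].
Proof.
move=> Eij; have in_sc k q : k \in sc G j -> path D k q -> last k q = j ->
    {in k :: q, forall x, x \in sc G j}.
  rewrite mem_sc => /andP[_ jk] kq lq x xq; case/splitPl: xq kq lq => q1 q2 lq1.
  rewrite cat_path last_cat lq1 mem_sc => /andP[kq1 xq2] lq2; apply/andP; split.
    by apply/connectP; exists q2.
  by apply: connect_trans jk _; apply/connectP; exists q1.
have simple k : k \in sc G j -> exists q,
    [/\ path D k q, last k q = j, uniq (k :: q)
      & {in k :: q, forall x, x \in sc G j}].
  move=> kj; have /connectP[q kq] : connect D k j.
    by move: kj; rewrite mem_sc => /andP[].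
  case/shortenP: kq => q' kq' uq' _ lq; exists q'; split=> //.
  exact: in_sc kj kq' (esym lq).
have [ij|nij] := boolP (i \in sc G j).
  have [q [iq lq uq scq]] := simple i ij; exists q; split=> // x xq.
  by apply: scq; rewrite inE xq orbT.
have /andP[_ /exists_inP[k kj]] := Eij; case/predU1P=> [ik|ik].
  by rewrite -ik (negPf nij) in kj.
have [q [kq lq uq scq]] := simple k kj; exists (k :: q); split=> //.
- by rewrite /= ik.
- by rewrite cons_uniq uq andbT; apply: contra nij => /scq.
Qed.

Lemma spar_inducing_fwd i j : spar G i j -> exists s, inducing_path G i j s.
Proof.
case/spar_path=> p [ip lp up scp]; exists [seq (Fwd, y) | y <- p].
have nodes : unzip2 [seq (Fwd, y) | y <- p] = p by rewrite /unzip2 -map_comp map_id.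
split; last 1 first.
- move=> u e k f l /inner_map[-> -> [p1 [p2 /mem_triple[kp lp']]]].
  split=> // _ [[]|[_]] //; apply/negP; rewrite negbK.
  by apply: sc_trans (scp _ lp') _; rewrite sc_sym; apply: scp.
- rewrite /is_path /walk_nodes nodes up andbT.
  by elim: (p) (i) ip => //= y q IHq x /andP[-> /IHq].
by rewrite /walk_end nodes.
Qed.

Lemma spar_inducing_bwd i j : spar G j i -> exists s, inducing_path G i j s.
Proof.
case/spar_path=> q [jq lq uq scq]; pose p := rev (belast j q).
have ip_rev : i :: p = rev (j :: q) by rewrite [j :: q]lastI rev_rcons lq.
exists [seq (Bwd, y) | y <- p].
have nodes : unzip2 [seq (Bwd, y) | y <- p] = p by rewrite /unzip2 -map_comp map_id.
split; last 1 first.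
- move=> u e k f l /inner_map[-> -> [p1 [p2]]].
  rewrite ip_rev => /(congr1 rev); rewrite revK rev_cat !rev_cons -!cats1 -!catA /=.
  case/mem_triple=> kq uq'; split=> // _ [[_]|[]] //; apply/negP; rewrite negbK.
  by apply: sc_trans (scq _ uq') _; rewrite sc_sym; apply: scq.
- rewrite /is_path /walk_nodes nodes ip_rev rev_uniq uq andbT.
  have: path (fun x y => D y x) i p by rewrite -lq rev_path.
  by elim: (p) (i) => //= y r IHr x /andP[-> /IHr].
by rewrite /walk_end nodes /p; case: (q) lq => //= y r _; rewrite rev_cons last_rcons.
Qed.

Lemma skel_inducing i j : i != j ->
  skel (spar G) i j <-> exists s, inducing_path G i j s.
Proof.
move=> nij; split=> [/orP[/spar_inducing_fwd|/spar_inducing_bwd] //|[s]].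
exact: inducing_skel.
Qed.
End InducingPaths.

(** * The skeleton and the v-structures found by the PC algorithm *)

Section PairwiseSeparation.
Variables (V : finType) (E : rel V).
Hypothesis qE : quasi_dag E.

Section Connected.
Variables (Z : {set V}) (i j : V).
Hypotheses (nZi : i \notin Z) (nZj : j \notin Z).
Local Notation W := (i |: (j |: Z)).

Lemma left_end_anc : i \in anc E W :\: Z.
Proof. by rewrite in_setD nZi mem_anc // !inE eqxx. Qed.

Lemma right_end_anc : j \in anc E W :\: Z.
Proof. by rewrite in_setD nZj mem_anc // !inE eqxx orbT. Qed.

Lemma mconn_skel : i != j -> skel E i j -> mconn E Z i j.
Proof.
by move=> nij Sij; apply/connect1/moral_skel; rewrite ?left_end_anc ?right_end_anc.
Qed.

Lemma mconn_collider c : c \in Z -> vstruct E i c j -> mconn E Z i j.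
Proof.
move=> Zc /and4P[nij _ Eic Ejc]; apply: connect1.
apply: (moral_intro nij left_end_anc right_end_anc (c := c)).
- by rewrite mem_anc // !inE Zc !orbT.
- by rewrite /fam Eic orbT.
by rewrite /fam Ejc orbT.
Qed.

Lemma mconn_noncollider c : c \notin Z -> skel E i c -> skel E c j ->
  E c i || E c j -> mconn E Z i j.
Proof.
move=> nZc Sic Scj Ec.
have Tc : c \in anc E W :\: Z.
  rewrite in_setD nZc; case/orP: Ec => /connect1/anc_connect; apply.
    by case/setDP: left_end_anc.
  by case/setDP: right_end_anc.
have neq x y : skel E x y -> x != y.
  by apply: contraTneq => ->; rewrite /skel (qd_irr qE).
apply: (@connect_trans _ _ c); apply/connect1/moral_skel; rewrite ?neq //.
  exact: left_end_anc.
exact: right_end_anc.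
Qed.
End Connected.

(** Only [i] and [j] remain in the moral graph, so that they would have to be
    married by a common child [c] that is an ancestor of one of them.  This one
    then has the same parents as [c], among them the other. *)
Lemma mconn_nonadj i j : i != j -> ~~ skel E i j ->
  ~~ mconn E (anc E [set i; j] :\: [set i; j]) i j.
Proof.
move=> nij nS; set Z := _ :\: _; apply/negP=> /connectP[[|v p] /=].
  by move=> _ /esym/eqP; rewrite (negPf nij).
case/andP=> /and4P[niv _ /setDP[Wv nZv] /exists_inP[c Wc /andP[ic vc]]] _ _.
have sub x : x \in anc E (i |: (j |: Z)) -> x \in anc E [set i; j].
  case/ancP=> w Ww xw; apply: anc_connect xw _.
  have: w \in [set i; j] :|: Z by rewrite -setUA.
  by case/setUP=> [|/setDP[]//]; apply: mem_anc.
have vj : v = j.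
  move: nZv; rewrite in_setD sub // andbT negbK !inE eq_sym (negPf niv).
  by move/eqP.
rewrite {}vj {v niv Wv nZv} in vc.
have strict x y : E x c -> fam E y c -> x != y -> E c x -> skel E x y.
  move=> Exc yc nxy Ecx; case/predU1P: yc => [->|Eyc]; first by rewrite /skel Exc.
  by rewrite /skel (qd_clique qE Eyc Ecx Exc) ?orbT // eq_sym.
case/negP: nS; case/predU1P: (ic) => [eic|Eic].
  case/predU1P: (vc) => [ejc|Ejc]; first by rewrite eic ejc eqxx in nij.
  by rewrite eic /skel Ejc orbT.
case/predU1P: (vc) => [->|Ejc]; first by rewrite /skel Eic.
have /ancP[w] := sub _ Wc; rewrite !inE => /orP[]/eqP-> cw.
  exact: strict Eic vc nij (qd_back qE Eic cw).
by rewrite skelC; apply: strict Ejc ic _ (qd_back qE Ejc cw); rewrite eq_sym.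
Qed.
End PairwiseSeparation.

Section Skeleton.
Variables (V : finType) (G : dmg V).
Hypothesis csG : causally_sufficient G.
Local Notation E := (spar G).
Local Notation I := (IM_sigma G).

(** The disjunction in [separates] collapses by the symmetry of moral
    connection. *)
Lemma separatesE i j Z :
  separates I i j Z = (Z \subset ~: [set i; j]) && ~~ mconn E Z i j.
Proof.
rewrite /separates; have [/subsetP sZ|//] := boolP (Z \subset _) => /=.
have nZi : i \notin Z by apply/negP=> /sZ; rewrite !inE eqxx.
have nZj : j \notin Z by apply/negP=> /sZ; rewrite !inE eqxx orbT.
have one x y : x \notin Z -> y \notin Z ->
    (([set x], [set y], Z) \in I) = ~~ mconn E Z x y.
  move=> nZx nZy; rewrite inE /=; apply/asboolP/idP.
    by move/(sigma_separatedP _ _ _ csG); apply; rewrite ?inE.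
  move=> nc; apply/(sigma_separatedP _ _ _ csG) => a b.
  by rewrite !inE => /eqP-> /eqP->.
by rewrite !one // (mconnC E Z j i) orbb.
Qed.

Lemma pc_adjE i j : pc_adj I i j = skel E i j.
Proof.
rewrite /pc_adj; have [->|nij] /= := eqVneq i j.
  by rewrite /skel (qd_irr (quasi_spar G)).
apply/idP/idP=> [|Sij].
  apply: contraR => nS; apply/existsP.
  exists (anc E [set i; j] :\: [set i; j]).
  rewrite separatesE (mconn_nonadj (quasi_spar G) nij nS) andbT.
  by apply/subsetP=> x /setDP[_]; rewrite in_setC.
apply/existsP=> -[Z]; rewrite separatesE => /andP[/subsetP sZ]; apply/negP.
rewrite negbK; apply: mconn_skel => //; apply/negP=> /sZ;
  by rewrite !inE eqxx ?orbT.
Qed.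

(** No choice of separating sets matters: conditioning on a collider [c] marries
    [a] and [b], and a non-collider outside the separating set is an ancestor of
    [a] or [b] and connects them. *)
Lemma pc_vstructE S a c b : is_sepset I S -> pc_vstruct I S a c b = vstruct E a c b.
Proof.
case=> _ sep; rewrite /pc_vstruct !pc_adjE.
have [|] := boolP [&& skel E a c, skel E c b, a != b & ~~ skel E a b]; last first.
  rewrite /vstruct => nh; apply/idP/idP; apply: contraLR => _; apply: contra nh.
    by case/and5P=> -> -> -> ->.
  by case/and4P=> -> -> Eac Ebc; rewrite /skel Eac Ebc orbT.
case/and4P=> Sac Scb nab nSab; rewrite Sac Scb nab nSab /=.
have := sep a b nab; rewrite pc_adjE separatesE => /(_ nSab)/andP[/subsetP sZ nM].
have nZa : a \notin S a b by apply/negP=> /sZ; rewrite !inE eqxx.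
have nZb : b \notin S a b by apply/negP=> /sZ; rewrite !inE eqxx orbT.
rewrite /vstruct nab nSab /=; apply/idP/idP=> [nZc|/andP[Eac Ebc]].
  apply: contraR nM => nE; apply: (mconn_noncollider _ nZa nZb nZc Sac Scb).
    exact: quasi_spar.
  move: nE Sac Scb; rewrite negb_and /skel => /orP[]/negPf->; rewrite ?orbF //=.
    by move=> ->.
  by move=> _ ->; rewrite orbT.
apply: contra nM => Zc; apply: (mconn_collider nZa nZb Zc).
by rewrite /vstruct nab nSab Eac.
Qed.

(** What the algorithm starts from, without reference to an independence
    model. *)
Definition pattern (E : rel V) : mgraph V :=
  [ffun x =>
    if ~~ skel E x.1 x.2 then None
    else if [exists b, vstruct E x.1 x.2 b] then Some Arrow
    else Some Tail].

Lemma pc_patternE S : is_sepset I S -> pc_skeleton_vstruct I S = pattern E.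
Proof.
move=> sS; apply/ffunP=> x; rewrite !ffunE pc_adjE.
by rewrite (eq_existsb (fun b => pc_vstructE x.1 x.2 b sS)).
Qed.
End Skeleton.

(** * Meek's rules *)

Section Meek.
Variables (V : finType) (E : rel V).
Hypothesis qE : quasi_dag E.

(** An invariant of the runs of Meek's rules.  In particular every arrowhead
    is strict, which excludes bidirected edges. *)
Record orientation (P : mgraph V) : Prop := Orientation {
  or_adj : adj P =2 skel E;
  or_mark : forall a b, P (a, b) != Some Circle;
  or_strict : forall a b, P (a, b) = Some Arrow -> E a b && ~~ E b a;
  or_vstruct : forall a c b, vstruct E a c b -> P (a, c) = Some Arrow }.

Lemma pattern_orientation : orientation (pattern E).
Proof.
split=> [a b|a b|a b|a c b].
- by rewrite /adj ffunE /=; case: (skel E a b) => //=; case: ifP.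
- by rewrite ffunE; case: ifP => //; case: ifP.
- rewrite ffunE /=; case: ifP => // _; case: existsP => // -[c Vabc] _.
  by rewrite (vstruct_strict qE Vabc) andbT; case/and4P: Vabc.
move=> Vacb; have /and4P[_ _ Eac _] := Vacb; rewrite ffunE /= /skel Eac /=.
by case: existsP => // -[]; exists b.
Qed.

Section Orientation.
Variable P : mgraph V.
Hypothesis oP : orientation P.

Lemma or_directed a b : directed P a b = (P (a, b) == Some Arrow).
Proof.
rewrite /directed; have [/(or_strict oP)/andP[Eab nEba]|//] := eqVneq.
have : adj P b a by rewrite (or_adj oP) /skel Eab orbT.
have := or_mark oP b a; rewrite /adj; case Pba: (P (b, a)) => [[]|] //.
by have := or_strict oP Pba; rewrite (negPf nEba).
Qed.

Lemma directed_strict a b : directed P a b -> E a b && ~~ E b a.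
Proof. by rewrite or_directed => /eqP/(or_strict oP). Qed.

Lemma directed_adj a b : directed P a b -> adj P a b.
Proof. by rewrite (or_adj oP) /skel => /directed_strict/andP[->]. Qed.

Lemma undirected_adj a b : undirected P a b -> adj P a b.
Proof. by rewrite /adj => /andP[/eqP->]. Qed.

Lemma adjC a b : adj P a b = adj P b a.
Proof. by rewrite !(or_adj oP) skelC. Qed.

Lemma adj_neq a b : adj P a b -> a != b.
Proof.
by rewrite (or_adj oP); apply: contraTneq => ->; rewrite /skel (qd_irr qE).
Qed.

Lemma undirectedC a b : undirected P a b = undirected P b a.
Proof. by rewrite /undirected andbC. Qed.

Lemma adjP a b : adj P a b -> [\/ directed P a b, directed P b a | undirected P a b].
Proof.
move=> Pab; have Pba := Pab; rewrite adjC in Pba.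
have [dab|ndab] := boolP (directed P a b); first by constructor 1.
have [dba|ndba] := boolP (directed P b a); [by constructor 2|constructor 3].
move: ndab ndba Pab Pba (or_mark oP a b) (or_mark oP b a).
rewrite !or_directed /undirected /adj.
by case: (P (a, b)) => [[]|] //; case: (P (b, a)) => [[]|].
Qed.

Lemma directed_undirected a b : directed P a b -> ~~ undirected P a b.
Proof. by case/andP=> /eqP + _; rewrite /undirected => ->. Qed.

Lemma undirected_no_vstruct a c b : undirected P a c -> ~~ vstruct E a c b.
Proof. by case/andP=> /eqP + _; apply: contra_eqN => /(or_vstruct oP)->. Qed.

(** In each rule the opposite direction [b -> a] in [E] would create a
    v-structure absent from [P] (rules 1 and 3), or a directed path that returns
    along a strict edge (rules 2 and 3). *)
Lemma meek_strict a b : meek_applicable P a b -> E a b && ~~ E b a.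
Proof.
move=> mab; have Pab := meek_applicable_undirected mab.
have Sab : skel E a b by rewrite -(or_adj oP) undirected_adj.
suff nEba : ~~ E b a.
  by rewrite nEba andbT; move: Sab; rewrite /skel (negPf nEba) orbF.
case/or3P: mab.
- case/existsP=> c /and4P[/directed_strict/andP[Eca _] _ ncb].
  rewrite (or_adj oP) => nScb; apply/negP=> Eba.
  rewrite undirectedC in Pab; apply: (negP (undirected_no_vstruct c Pab)).
  by rewrite /vstruct eq_sym ncb skelC nScb Eba.
- case/andP=> _ /existsP[c /andP[/directed_strict/andP[Eac nEca]]].
  move=> /directed_strict/andP[Ecb _]; apply: contra nEca => Eba.
  apply: (qd_back qE Eac); exact: connect_trans (connect1 Ecb) (connect1 Eba).
case/andP=> _ /existsP[c /existsP[d]].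
case/and5P=> Pac Pad dcb ddb /andP[ncd]; rewrite (or_adj oP) => nScd.
apply/negP=> Eba; have strict x : undirected P a x -> directed P x b -> E x a.
  move=> Pax /directed_strict/andP[Exb nEbx].
  have: skel E a x by rewrite -(or_adj oP) undirected_adj.
  case/orP=> // Eax; case/negP: nEbx; apply: (qd_back qE Exb).
  exact: connect_trans (connect1 Eba) (connect1 Eax).
rewrite undirectedC in Pac; apply: (negP (undirected_no_vstruct d Pac)).
by rewrite /vstruct ncd nScd !strict // undirectedC.
Qed.

Lemma orient_orientation a b : meek_applicable P a b -> orientation (orient P a b).
Proof.
move=> mab; have Pab := meek_applicable_undirected mab.
split=> [x y|x y|x y|x c y].
- rewrite -(or_adj oP) /adj ffunE; case: ifP => // /eqP[-> ->].
  by case/andP: Pab => /eqP->.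
- by rewrite ffunE; case: ifP => // _; apply: or_mark oP _ _.
- rewrite ffunE; case: ifP => [/eqP[-> ->] _|_ /(or_strict oP)//].
  exact: meek_strict.
by rewrite ffunE; case: ifP => // _; apply: or_vstruct oP _ _ _.
Qed.

End Orientation.

Definition meek_closed (Q : mgraph V) : Prop := forall a b, ~~ meek_applicable Q a b.

Lemma run_orientation P Q : meek_run P Q -> orientation P ->
  [/\ orientation Q, meek_closed Q & forall x, P x = Some Arrow -> Q x = Some Arrow].
Proof.
elim=> {P Q} [P Q <- cP|P Q a b mab _ IH] oP; first by [].
have [oQ cQ PQ] := IH (orient_orientation oP mab); split=> // x Px.
by apply: PQ; rewrite ffunE; case: ifP.
Qed.

Section Closure.
Variable Q : mgraph V.
Hypotheses (oQ : orientation Q) (cQ : meek_closed Q).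

Lemma rule1_closed a b c : directed Q a b -> undirected Q b c -> a != c -> adj Q a c.
Proof.
move=> ab bc ac; apply: contraNT (cQ b c) => nac; apply/or3P; constructor 1.
by apply/existsP; exists a; rewrite ab bc ac.
Qed.

Lemma rule2_closed a b c : directed Q a b -> directed Q b c -> ~~ undirected Q a c.
Proof.
move=> ab bc; apply: contra (cQ a c) => ac; apply/or3P; constructor 2.
by rewrite /meek2 ac; apply/existsP; exists b; rewrite ab.
Qed.

Lemma rule3_closed a b c d : undirected Q a b -> undirected Q a c -> undirected Q a d ->
  directed Q c b -> directed Q d b -> c != d -> adj Q c d.
Proof.
move=> ab ac ad cb db ncd; apply: contraNT (cQ a b) => nScd; apply/or3P.
constructor 3; rewrite /meek3 ab; apply/existsP; exists c; apply/existsP.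
by exists d; rewrite ac ad cb db ncd.
Qed.

Lemma closed_absorb a b c : directed Q a b -> undirected Q b c ->
  ~~ undirected Q a c -> directed Q a c.
Proof.
move=> ab bc nac; have nac' : a != c.
  apply: contraTneq bc => <-; rewrite undirectedC.
  exact: directed_undirected ab.
case/(adjP oQ): (rule1_closed ab bc nac') => // [ca|ac]; last by rewrite ac in nac.
by have := rule2_closed ca ab; rewrite undirectedC bc.
Qed.

(** The part of [directed_absorb] that depends on how an arrow came about.  The
    final graph [Q] is fixed, so that for the arrows of the intermediate graphs [P]
    this can be proved by induction on the run. *)
Definition absorbing (P : mgraph V) : Prop := forall a b c,
  P (a, b) = Some Arrow -> undirected Q b c -> ~~ undirected Q a c.

(** For a v-structure [a -> b <- d] and [c] with [a - c] and [b - c] in [Q],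
    either [d - c], and rule 3 orients [c -> b], or [d -> c], and rule 1 orients
    [c -> a]. *)
Lemma pattern_absorbing : absorbing (pattern E).
Proof.
move=> a b c; rewrite ffunE /=; case: (skel E a b) => //=.
case: existsP => // -[d Vabd] _ bc; apply/negP=> ac.
have arrow x y z : vstruct E x y z -> directed Q x y.
  by move=> /(or_vstruct oQ) xy; rewrite (or_directed oQ) xy.
have ab := arrow _ _ _ Vabd; have db : directed Q d b.
  by apply: (arrow _ _ a); rewrite vstructC.
have /and4P[nad nSad _ _] := Vabd.
have [dc|ndc] := boolP (undirected Q d c).
  case/negP: nSad; rewrite -(or_adj oQ).
  by apply: (@rule3_closed c b a d) => //; rewrite undirectedC.
have dc := closed_absorb db bc ndc.
case/negP: nSad; rewrite skelC -(or_adj oQ); apply: (rule1_closed dc).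
  by rewrite undirectedC.
by rewrite eq_sym.
Qed.

(** Suppose [a - c] and [b - c] are left in [Q] after [a -> b] was oriented.
    The induction hypothesis carries the directed edges in the premises of the
    rule over to [c]: those into [a] (rule 1) or into [b] (rules 2 and 3).  Then one
    of the rules, or a v-structure, orients an edge that is undirected. *)
Lemma orient_absorbing P a b : orientation P ->
  (forall x, P x = Some Arrow -> Q x = Some Arrow) ->
  absorbing P -> meek_applicable P a b -> directed Q a b -> absorbing (orient P a b).
Proof.
move=> oP PQ aP mab dab x y c; rewrite ffunE; case: ifP => [/eqP[-> ->] _ {x y}|_];
  last exact: aP.
have sub u v : directed P u v -> directed Q u v.
  by rewrite (or_directed oP) (or_directed oQ) => /eqP/PQ->.
have absorb u v w : directed P u v -> undirected Q v w -> directed Q u w.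
  move=> uv vw; apply: (closed_absorb (sub _ _ uv) vw).
  by apply: aP vw; apply/eqP; rewrite -(or_directed oP).
move=> bc; apply/negP=> ac.
case/or3P: mab.
- case/existsP=> d /and4P[da _ ndb nSdb].
  have dc := absorb _ _ _ da ac.
  case/negP: nSdb; rewrite (or_adj oP) -(or_adj oQ); apply: rule1_closed dc _ ndb.
  by rewrite undirectedC.
- case/andP=> _ /existsP[d /andP[ad db]].
  have dc := absorb _ _ _ db bc.
  by have := rule2_closed (sub _ _ ad) dc; rewrite ac.
case/andP=> _ /existsP[d /existsP[e /and5P[uad uae db eb /andP[nde nSde]]]].
have dc := absorb _ _ _ db bc; have ec := absorb _ _ _ eb bc.
rewrite (or_adj oP) in nSde.
have undir x : undirected P a x -> directed Q x c ->
    directed Q x a \/ undirected Q a x.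
  move=> ax xc; have : adj Q a x by rewrite (or_adj oQ) -(or_adj oP) undirected_adj.
  case/(adjP oQ) => [ax'||]; [|by left|by right].
  by have := rule2_closed ax' xc; rewrite ac.
have nadj : ~~ adj Q d e by rewrite (or_adj oQ).
have und x y : x != y -> ~~ adj Q x y -> directed Q x a -> ~~ undirected Q a y.
  by move=> nxy nSxy xa; apply: contra nSxy => ay; apply: rule1_closed xa ay nxy.
case: (undir d uad dc) (undir e uae ec) => [da|ad] [ea|ae].
- (* Two strict arrowheads at [a] from non-adjacent nodes are a v-structure, so
     [d -> a] was there from the start. *)
  have : vstruct E d a e.
    rewrite /vstruct nde nSde.
    by case/andP: (directed_strict oQ da) => -> _; case/andP: (directed_strict oQ ea).
  by apply/negP; apply: (undirected_no_vstruct oP); rewrite undirectedC.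
- by move: ae; apply/negP; apply: und da.
- by move: ad; apply/negP; apply: und ea; rewrite 1?eq_sym // (adjC oQ).
by case/negP: nadj; apply: (rule3_closed ac).
Qed.
End Closure.

Lemma run_absorbing P Q : meek_run P Q -> orientation P -> absorbing Q P ->
  absorbing Q Q.
Proof.
elim=> {P Q} [P Q <- //|P Q a b mab run IH] oP aP.
have oP' := orient_orientation oP mab.
have [oQ cQ PQ] := run_orientation run oP'.
apply: IH => //; apply: orient_absorbing => //.
  by move=> x Px; apply: PQ; rewrite ffunE; case: ifP.
by rewrite (or_directed oQ) PQ // ffunE eqxx.
Qed.

Variable Q : mgraph V.
Hypothesis runQ : meek_run (pattern E) Q.

Lemma closure_orientation : orientation Q.
Proof. by have [] := run_orientation runQ pattern_orientation. Qed.

Lemma closure_closed : meek_closed Q.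
Proof. by have [] := run_orientation runQ pattern_orientation. Qed.

(** Hence nodes connected by undirected edges have the same directed parents, and
    no directed edge joins two of them. *)
Lemma directed_absorb a b c : directed Q a b -> undirected Q b c -> directed Q a c.
Proof.
have [oQ cQ] := (closure_orientation, closure_closed).
move=> ab bc; apply: (closed_absorb oQ cQ ab bc).
have aQ : absorbing Q Q.
  exact: run_absorbing runQ pattern_orientation (pattern_absorbing oQ cQ).
by apply: aQ bc; apply/eqP; rewrite -(or_directed oQ).
Qed.
End Meek.

(** * Orienting the undirected edges *)

Section PerfectOrders.
Variables (V : finType) (U : rel V).
Hypothesis symU : symmetric U.

Definition clique (A : {set V}) : Prop :=
  {in A &, forall u v, u != v -> U u v}.

Definition simplicial (A : {set V}) (w : V) : Prop :=
  {in A &, forall u v, U u w -> U v w -> u != v -> U u v}.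

Hypothesis has_simplicial : forall A : {set V}, A != set0 ->
  exists2 w, w \in A & simplicial A w.

Lemma simplicialD1 (A : {set V}) a w :
  simplicial (A :\ a) w -> ~~ U a w -> simplicial A w.
Proof.
move=> sw naw u v Au Av uw vw; apply: sw => //; rewrite !inE ?Au ?Av andbT;
  by apply: contraNneq naw => <-.
Qed.

(** By induction on [A], removing a simplicial vertex [a].  The neighbours of
    [a] form a clique, so one of two non-adjacent vertices is not among them and
    remains simplicial in [A]. *)
Lemma dirac (A : {set V}) : clique A \/ exists w1 w2,
  [/\ w1 \in A, w2 \in A, ~~ U w1 w2, w1 != w2 & simplicial A w1 /\ simplicial A w2].
Proof.
have [n] := ubnP #|A|; elim: n A => // n IHn A /ltnSE-leAn.
have [->|A0] := eqVneq A set0; first by left=> u v; rewrite inE.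
have [a Aa sa] := has_simplicial A0.
have nonadj w : w \in A :\ a -> simplicial (A :\ a) w -> ~~ U a w ->
    exists w1 w2, [/\ w1 \in A, w2 \in A, ~~ U w1 w2, w1 != w2
      & simplicial A w1 /\ simplicial A w2].
  case/setD1P=> nwa Aw sw naw; exists a, w; split=> //; first by rewrite eq_sym.
  by split=> //; apply: simplicialD1 naw.
have [|cA|] := IHn (A :\ a).
- by apply: leq_trans leAn; rewrite [in X in _ <= X](cardsD1 a) Aa.
- have [/exists_inP[w Aw naw]|nex] := boolP [exists w in A :\ a, ~~ U a w].
    right; apply: nonadj Aw _ naw => u v Au Av _ _; exact: cA.
  have toa w : w \in A -> w != a -> U a w.
    move=> Aw nwa; apply: contraNT nex => naw; apply/exists_inP.
    by exists w; rewrite // !inE nwa.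
  left=> u v Au Av nuv; have [eua|nua] := eqVneq u a.
    by rewrite eua toa // -eua eq_sym.
  have [eva|nva] := eqVneq v a; first by rewrite symU eva toa.
  by apply: cA; rewrite // !inE ?nua ?nva.
case=> w1 [w2 [Aw1 Aw2 nw12 n12 [s1 s2]]]; right.
have [aw1|] := boolP (U a w1); last exact: nonadj.
have [aw2|] := boolP (U a w2); last exact: nonadj.
have [/setD1P[_ Aw1'] /setD1P[_ Aw2']] := (Aw1, Aw2).
by case/negP: nw12; apply: sa; rewrite // symU.
Qed.

Lemma simplicial_neq (A : {set V}) a : (exists2 x, x \in A & x != a) ->
  exists w, [/\ w \in A, w != a & simplicial A w].
Proof.
case=> x Ax nxa; case: (dirac A) => [cA|[w1 [w2 [A1 A2 _ n12 [s1 s2]]]]].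
  by exists x; split=> // u v Au Av _ _; apply: cA.
have [e1|n1] := eqVneq w1 a; last by exists w1.
by exists w2; rewrite -e1 eq_sym.
Qed.

(** A simplicial vertex other than [a], which exists by [dirac], may be put last;
    the rest is ordered by induction. *)
Lemma perfect_order_from (A : {set V}) a : a \in A -> exists r : V -> nat,
  [/\ {in A, forall x, x != a -> r a < r x}, {in A &, injective r}
    & {in A & &, forall u v w, U u w -> U v w -> r u < r w -> r v < r w ->
         u != v -> U u v}].
Proof.
have [n] := ubnP #|A|; elim: n A => // n IHn A /ltnSE-leAn Aa.
have [/exists_inP[x Ax nxa]|nex] := boolP [exists x in A, x != a]; last first.
  have eqa x : x \in A -> x = a.
    move=> Ax; apply/eqP; apply: contraNT nex => nxa.
    by apply/exists_inP; exists x.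
  exists (fun=> 0); split=> [x /eqa->|x y /eqa-> /eqa-> //|u v w] //.
  by rewrite eqxx.
have [|w [Aw nwa sw]] := @simplicial_neq A a; first by exists x.
have [||r [ra ri rp]] := IHn (A :\ w).
- by apply: leq_trans leAn; rewrite [in X in _ <= X](cardsD1 w) Aw.
- by rewrite !inE eq_sym nwa.
pose m := (\max_y r y).+1; pose r' y := if y == w then m else r y.
have ltm y : r y < m by rewrite ltnS leq_bigmax.
have inD y : y \in A -> y != w -> y \in A :\ w by move=> Ay nyw; rewrite !inE nyw.
exists r'; rewrite /r'; split.
- move=> y Ay nya; rewrite [a == w]eq_sym (negPf nwa).
  by case: eqVneq => [_|nyw]; [apply: ltm | apply: ra => //; apply: inD].
- move=> y z Ay Az; case: eqVneq => [->|nyw]; case: eqVneq => [->|nzw] //.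
  + by move=> em; have := ltm z; rewrite -em ltnn.
  + by move=> em; have := ltm y; rewrite em ltnn.
  by apply: ri; apply: inD.
move=> u v y Au Av Ay uy vy; have [eyw|nyw] := eqVneq y w.
  by rewrite eyw in uy vy; move=> _ _; apply: sw.
case: eqVneq => [_|nuw]; first by rewrite ltnNge ltnW.
case: eqVneq => [_|nvw]; first by rewrite [m < _]ltnNge (ltnW (ltm _)).
by apply: rp => //; apply: inD.
Qed.
End PerfectOrders.

Section Extension.
Variables (V : finType) (E : rel V).
Hypothesis qE : quasi_dag E.
Variable Q : mgraph V.
Hypothesis runQ : meek_run (pattern E) Q.
Local Notation U := (undirected Q).
Let oQ : orientation E Q := closure_orientation qE runQ.
Let absorb a b c : directed Q a b -> U b c -> directed Q a c.
Proof. exact: (directed_absorb qE runQ). Qed.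

(** This is the chordality of the undirected part.  A node with a maximal set of
    ancestors is a child of all its undirected neighbours; they are adjacent, as
    there would be a v-structure otherwise, and the edge between them is
    undirected, by [directed_absorb]. *)
Lemma undirected_simplicial (A : {set V}) : A != set0 ->
  exists2 w, w \in A & simplicial U A w.
Proof.
case/set0Pn=> x0 Ax0.
(* The largest set of ancestors serves as a last node in an order compatible
   with [E], which may have cycles. *)
pose w := [arg max_(w > x0 in A) #|anc E [set w]|].
have [Aw maxw] : w \in A /\ forall u, u \in A -> #|anc E [set u]| <= #|anc E [set w]|.
  by rewrite /w; case: arg_maxnP.
have Euw u : u \in A -> U u w -> E u w.
  move=> Au uw; have: skel E u w by rewrite -(or_adj oQ) undirected_adj.
  case/orP=> // Ewu; apply: (qd_back qE Ewu).
  have sub : anc E [set w] \subset anc E [set u].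
    apply/subsetP=> x; case/ancP=> _ /set1P-> xw; apply/ancP; exists u.
      exact: set11.
    exact: connect_trans xw (connect1 Ewu).
  have /eqP eqw : anc E [set w] == anc E [set u] by rewrite eqEcard sub maxw.
  have: u \in anc E [set w] by rewrite eqw mem_anc ?set11.
  by case/ancP=> _ /set1P->.
exists w => // u v Au Av uw vw nuv.
have: adj Q u v.
  rewrite (or_adj oQ); apply: contraT => nS.
  case/negP: (undirected_no_vstruct oQ v uw).
  by rewrite /vstruct nuv nS !Euw.
case/(adjP oQ) => // [duv|dvu].
  have := directed_absorb qE runQ duv vw.
  by move/directed_undirected; rewrite uw.
have := directed_absorb qE runQ dvu uw.
by move/directed_undirected; rewrite vw.
Qed.

Section Ordered.
Variable r : V -> nat.
Hypothesis inj_r : injective r.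
Hypothesis perfect_r : forall u v w, U u w -> U v w -> r u < r w -> r v < r w ->
  u != v -> U u v.

Definition extend (i j : V) : bool := directed Q i j || (U i j && (r i < r j)).

(** A normal form of the nonempty paths of [extend], in which no undirected
    edge of [Q] follows a directed one. *)
Definition forward (x y : V) : Prop :=
  connect U x y /\ r x < r y \/
  exists a b, [/\ connect U x a, connect (directed Q) a b & directed Q b y].

Lemma forward1 x y : extend x y -> forward x y.
Proof.
case/orP=> [xy|/andP[xy rxy]]; last by left; rewrite connect1.
by right; exists x, x; rewrite !connect0.
Qed.

(** An undirected edge [y - z] after a directed edge into [y] is absorbed into
    this directed edge. *)
Lemma forward_step x y z : forward x y -> extend y z -> forward x z.
Proof.
move=> xy /orP[yz|/andP[yz ryz]].
  case: xy => [[xy _]|[a [b [xa ab bxy]]]]; right.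
    by exists y, y; rewrite xy connect0.
  by exists a, y; split=> //; apply: connect_trans ab (connect1 bxy).
case: xy => [[xy rxy]|[a [b [xa ab bxy]]]]; [left|right].
  by rewrite (connect_trans xy (connect1 yz)) (ltn_trans rxy).
by exists a, b; split=> //; apply: absorb bxy yz.
Qed.

(** On a closed path with directed edges, the undirected edges at its beginning
    follow the last directed edge, which absorbs them and leaves a directed cycle
    of strict edges. *)
Lemma forward_irr x : ~ forward x x.
Proof.
case=> [[_]|[a [b [/connectP[p xp ->]]]]]; first by rewrite ltnn.
move=> ab bx; have {bx xp}: directed Q b (last x p).
  elim: p x xp {ab} bx => //= y p IHp x /andP[xy yp] bx.
  by apply: IHp yp _; apply: absorb bx xy.
move=> /(directed_strict oQ)/andP[Ebl nElb]; case/negP: nElb.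
apply: (qd_back qE Ebl); move: ab; apply: connect_sub => u v.
by move=> /(directed_strict oQ)/andP[/connect1].
Qed.

Lemma extend_acyclic x y : connect extend x y -> ~~ extend y x.
Proof.
move=> /connectP[p xp ly]; apply/negP=> /forward1.
suff fwd p' z : forward y z -> path extend z p' -> forward y (last z p').
  by move/fwd=> /(_ _ xp); rewrite -ly; apply: forward_irr.
elim: p' z => //= w p' IHp z yz /andP[zw wp].
exact: IHp (forward_step yz zw) wp.
Qed.

Lemma skel_extend : skel extend =2 skel E.
Proof.
move=> i j; rewrite -(or_adj oQ); apply/idP/idP.
  have half x y : extend x y -> adj Q x y.
    by case/orP=> [/(directed_adj oQ)|/andP[/undirected_adj]].
  by case/orP=> /half //; rewrite (adjC oQ).
move=> ij; rewrite /skel /extend.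
case/(adjP oQ): (ij) => [->|->|uij]; rewrite ?orbT //.
rewrite uij undirectedC uij.
have : r i != r j by apply: contra (adj_neq qE oQ ij) => /eqP/inj_r->.
by case: ltngtP; rewrite ?orbT.
Qed.

(** A collider with a directed and a newly oriented edge has adjacent parents by
    [directed_absorb], one with two newly oriented edges by the choice of [r]. *)
Lemma vstruct_extend a c b : vstruct extend a c b = vstruct E a c b.
Proof.
rewrite /vstruct skel_extend -(or_adj oQ); apply/idP/idP.
  case/and4P=> nab nSab; rewrite nab nSab /=.
  have strict x y : directed Q x y -> E x y.
    by case/(directed_strict oQ)/andP.
  case/orP=> [ac|/andP[ac rac]] /orP[bc|/andP[bc rbc]].
  - by rewrite !strict.
  - case/negP: nSab; apply: directed_adj oQ _ _ _.
    by apply: absorb ac _; rewrite undirectedC.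
  - case/negP: nSab; rewrite (adjC oQ); apply: directed_adj oQ _ _ _.
    by apply: absorb bc _; rewrite undirectedC.
  by case/negP: nSab; apply/undirected_adj/(perfect_r ac bc).
case/and4P=> nab nSab Eac Ebc; rewrite nab nSab /= /extend.
rewrite (or_adj oQ) in nSab.
have Vacb : vstruct E a c b by rewrite /vstruct nab nSab Eac.
have Vbca : vstruct E b c a by rewrite vstructC.
by rewrite !(or_directed oQ) (or_vstruct oQ Vacb) (or_vstruct oQ Vbca).
Qed.

Lemma extend_irr : irreflexive extend.
Proof. by move=> x; apply: negbTE; apply: extend_acyclic. Qed.

End Ordered.
End Extension.

Definition directed_dmg (V : finType) (e : rel V) (irr_e : irreflexive e) : dmg V :=
  @Dmg V e (fun _ _ => false) irr_e (fun=> erefl) (fun _ _ => erefl).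

Lemma acyclic_spar (V : finType) (G : dmg V) :
  (forall x y, connect (dir G) x y -> ~~ dir G y x) -> spar G =2 dir G.
Proof.
move=> acG x y; apply/idP/idP=> [|/dir_spar//].
case/andP=> nxy /exists_inP[k]; rewrite mem_sc => /andP[/connectP[[|z p] /=]].
  by move=> _ <- _; rewrite (negPf nxy).
case/andP=> kz zp ly yk; have := acG z k; rewrite kz => /(_ _)/negP[] //.
by apply: connect_trans yk; apply/connectP; exists p.
Qed.

(** Every edge left undirected has both directions in the class: exchange [a]
    and [b]. *)
Theorem meek_extension (V : finType) (E : rel V) (Q : mgraph V) (a b : V) :
  quasi_dag E -> meek_run (pattern E) Q -> undirected Q a b -> exists G,
    [/\ causally_sufficient G, skel (spar G) =2 skel E,
       forall x z y, vstruct (spar G) x z y = vstruct E x z y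
     & dir G a b /\ ~~ connect (dir G) b a].
Proof.
move=> qE runQ ab; have symU : symmetric (undirected Q).
  by move=> x y; apply: undirectedC.
have [r [ra ri rp]] := perfect_order_from symU (undirected_simplicial qE runQ)
  (in_setT a).
have inj_r : injective r by move=> x y; apply: ri; rewrite inE.
have perfect_r u v w : undirected Q u w -> undirected Q v w -> r u < r w ->
  r v < r w -> u != v -> undirected Q u v by apply: rp; rewrite inE.
have ac x y := @extend_acyclic _ _ qE _ runQ r x y.
pose G := directed_dmg (extend_irr qE runQ r).
have sparG : spar G =2 extend Q r by apply: acyclic_spar.
have skelG : skel (spar G) =2 skel E.
  by move=> x y; rewrite -(skel_extend qE runQ inj_r) /skel !sparG.
have Gab : dir G a b.
  rewrite /= /extend ab ra ?orbT ?inE // eq_sym.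
  exact: (adj_neq qE (closure_orientation qE runQ) (undirected_adj ab)).
exists G; split=> //; last first.
- by split=> //; apply: contraL Gab => /ac.
- move=> x z y; rewrite -(vstruct_extend qE runQ inj_r perfect_r).
  by rewrite /vstruct skelG (skel_extend qE runQ inj_r) !sparG.
Qed.

(** * The output of the algorithm *)

(** Separation of sets is separation of their elements outside [C], hence
    determined by moral connection, to which [mconn_transfer] applies. *)
Lemma sigma_Markov_equivP (V : finType) (G1 G2 : dmg V) :
  causally_sufficient G1 -> causally_sufficient G2 ->
  skel (spar G1) =2 skel (spar G2) ->
  (forall a c b, vstruct (spar G1) a c b = vstruct (spar G2) a c b) ->
  sigma_Markov_equiv G1 G2.
Proof.
move=> cs1 cs2 sS sV; apply/setP=> -[[A B] C]; rewrite !inE /=.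
have eq_mconn i j : mconn (spar G1) C i j = mconn (spar G2) C i j.
  apply/idP/idP; apply: mconn_transfer => //; exact: quasi_spar.
apply: asbool_equiv_eq.
split=> /sigma_separatedP sep; apply/sigma_separatedP=> // i j Ai Bj nCi nCj.
  by rewrite -eq_mconn; apply: sep.
by rewrite eq_mconn; apply: sep.
Qed.

Section Output.
Variables (V : finType) (E : rel V) (Q : mgraph V).
Hypotheses (qE : quasi_dag E) (runQ : meek_run (pattern E) Q).
Local Notation P := (undirected_to_circle Q).
Let oQ : orientation E Q := closure_orientation qE runQ.

Lemma output_arrow i j : (P (i, j) == Some Arrow) = directed Q i j.
Proof.
rewrite ffunE (or_directed oQ) /=.
by case: ifP => // /andP[/eqP-> _].
Qed.

Lemma output_adj : adj P =2 skel E.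
Proof.
move=> i j; rewrite -(or_adj oQ) /adj ffunE /=.
by case: ifP => // /andP[/eqP-> _].
Qed.

Lemma output_tail i j : P (i, j) = Some Tail -> directed Q j i.
Proof.
move=> Pij; have ij : adj Q i j by rewrite (or_adj oQ) -output_adj /adj Pij.
case/(adjP oQ): ij => [|//|uij].
  by rewrite -output_arrow Pij.
by move: Pij; rewrite ffunE /= uij.
Qed.

Lemma output_directed i j : directed P i j = directed Q i j.
Proof.
rewrite {1}/directed output_arrow; apply: andb_idr => dij; rewrite ffunE /=.
rewrite undirectedC (negPf (directed_undirected dij)).
by case/andP: dij.
Qed.

Lemma output_no_return i j : directed Q i j -> ~~ connect (directed P) j i.
Proof.
move=> /(directed_strict oQ)/andP[Eij nEji]; apply: contra nEji => ji.
apply: (qd_back qE Eij); move: ji; apply: connect_sub => u v.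
by rewrite output_directed => /(directed_strict oQ)/andP[/connect1].
Qed.

Lemma output_not_bidirected i j : directed Q i j -> ~~ directed Q j i.
Proof.
move=> dij; have := output_no_return dij; apply: contra => dji.
by rewrite connect1 // output_directed.
Qed.

(** All arrowheads are on directed edges, which are strict, hence acyclic.  So an
    inducing path of the DPAG has at most one inner node, as two consecutive
    colliders need a bidirected edge, and this node would be an ancestor of one of
    its own strict parents. *)
Lemma output_is_dpag : is_dpag P.
Proof.
split=> [i j|i|i j Pij|i j ij|i j _|i j p nij nPij].
- by rewrite !output_adj skelC.
- by rewrite output_adj /skel (qd_irr qE).
- by apply/eqP; rewrite output_arrow output_tail.
- by apply: contraL ij => ji; rewrite output_no_return // -output_directed.
- rewrite /bidirected !output_arrow; apply/negP=> /andP[dji].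
  exact/negP/output_not_bidirected.
case: p => [|k [|l p]] [] /=.
- by move=> _ _ eij; rewrite eij eqxx in nij.
- by rewrite andbT => Pik _ ekj; rewrite -ekj Pik in nPij.
move=> _ _ lj col.
have arrow u v : P (u, v) = Some Arrow -> directed Q u v.
  by rewrite -output_arrow => ->.
have [/arrow ik /arrow lk kij] := col [::] p i k l erefl.
case: p lj col => [/= elj _|m p _ col].
  rewrite elj in lk; case/orP: kij; apply/negP; exact: output_no_return.
have [/arrow kl _ _] := col [:: i] p k l m erefl.
by move/negP: (output_not_bidirected kl).
Qed.

Lemma output_vstruct a c b : vstruct E a c b =
  [&& a != b, ~~ adj P a b, P (a, c) == Some Arrow & P (b, c) == Some Arrow].
Proof.
rewrite output_adj !output_arrow; apply/idP/and4P => [Vacb|[nab nSab]].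
  have Vbca : vstruct E b c a by rewrite vstructC.
  have [nab nSab _ _] := and4P Vacb; split=> //; rewrite (or_directed oQ).
    by rewrite (or_vstruct oQ Vacb).
  by rewrite (or_vstruct oQ Vbca).
move=> /(directed_strict oQ)/andP[Eac _] /(directed_strict oQ)/andP[Ebc _].
by rewrite /vstruct nab nSab Eac.
Qed.

Lemma output_cases i j : adj P i j ->
  [\/ directed P i j, directed P j i | undirected Q i j].
Proof. by rewrite !output_directed output_adj -(or_adj oQ); apply: (adjP oQ). Qed.

Lemma output_directed_strict i j : directed P i j -> E i j && ~~ connect E j i.
Proof.
rewrite output_directed => /(directed_strict oQ)/andP[Eij nEji].
by rewrite Eij; apply: contra nEji; apply: qd_back.
Qed.
End Output.

Section Soundness.
Variables (V : finType) (G : dmg V) (Q : mgraph V).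
Hypotheses (csG : causally_sufficient G) (runQ : meek_run (pattern (spar G)) Q).
Local Notation P := (undirected_to_circle Q).
Let qE := quasi_spar G.

(** An arrowhead of the output is strict in [spar G], which has the same
    ancestors as [G]. *)
Lemma output_contains : contains P G.
Proof.
split=> [i j nij|i j Pij|i j].
- by rewrite (output_adj qE runQ) (skel_inducing csG nij).
- rewrite inE -connect_spar.
  have : directed P i j.
    by rewrite (output_directed qE runQ) -(output_arrow qE runQ) Pij.
  by case/(output_directed_strict qE runQ)/andP.
case/(output_directed_strict qE runQ)/andP=> Eij _.
by rewrite inE -connect_spar connect1.
Qed.

Lemma output_undirected i j : undirected Q i j -> exists G',
  [/\ causally_sufficient G', sigma_Markov_equiv G' G, i \in an G' j
    & j \notin an G' i].
Proof.
case/(meek_extension qE runQ) => G' [csG' sS sV [ij nji]].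
exists G'; split=> //; first exact: sigma_Markov_equivP.
  by rewrite inE connect1.
by rewrite inE.
Qed.

Lemma output_arrowhead_complete i j : adj P i j ->
  (forall G', causally_sufficient G' -> sigma_Markov_equiv G' G -> i \notin an G' j) ->
  P (j, i) = Some Arrow.
Proof.
move=> Pij nan; have [dij|/andP[/eqP] //|uij] := output_cases qE runQ Pij.
  have /andP[Eij _] := output_directed_strict qE runQ dij.
  by have := nan G csG erefl; rewrite inE -connect_spar connect1.
have [G' [csG' eqG' ij _]] := output_undirected uij.
by have := nan G' csG' eqG'; rewrite ij.
Qed.

Lemma output_tail_complete i j : adj P i j ->
  (forall G', causally_sufficient G' -> sigma_Markov_equiv G' G -> i \in an G' j) ->
  directed P i j.
Proof.
move=> Pij an_ij; have [//|dji|uij] := output_cases qE runQ Pij.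
  have /andP[_ /negP] := output_directed_strict qE runQ dji.
  by case; have := an_ij G csG erefl; rewrite inE connect_spar.
rewrite undirectedC in uij.
have [G' [csG' eqG' _ nij]] := output_undirected uij.
by have := an_ij G' csG' eqG'; rewrite (negPf nij).
Qed.
End Soundness.

Theorem corollary1 (V : finType) (Phi : indep_model V -> mgraph V)
    (hPhi : pc_meek_mapping Phi) :
  dpag_valued (@causally_sufficient V) Phi /\
  sound (@causally_sufficient V) Phi /\
  arrowhead_complete (@causally_sufficient V) Phi /\
  tail_complete (@causally_sufficient V) Phi /\
  Markov_complete (@causally_sufficient V) Phi.
Proof.
have out G : causally_sufficient G -> exists2 Q, meek_run (pattern (spar G)) Q
    & Phi (IM_sigma G) = undirected_to_circle Q.
  move=> csG; have [S [Q [sS run ->]]] := hPhi (IM_sigma G); exists Q => //.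
  by rewrite -(pc_patternE csG sS).
split; [|split; [|split; [|split]]].
- by move=> G /out[Q run ->]; apply: output_is_dpag run; apply: quasi_spar.
- by move=> G csG; have [Q run ->] := out G csG; apply: output_contains.
- move=> G csG i j _; have [Q run ->] := out G csG.
  exact: output_arrowhead_complete.
- move=> G csG i j _; have [Q run ->] := out G csG.
  exact: output_tail_complete.
move=> G1 G2 cs1 cs2; split=> [eqI|]; first by congr Phi.
have [Q1 run1 ->] := out G1 cs1; have [Q2 run2 ->] := out G2 cs2 => eqP.
have [q1 q2] := (quasi_spar G1, quasi_spar G2).
apply: sigma_Markov_equivP => // [i j|a c b].
  by rewrite -(output_adj q1 run1) eqP (output_adj q2 run2).
by rewrite (output_vstruct q1 run1) eqP -(output_vstruct q2 run2).
Qed.
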